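(* Let $V$ be a simple module over $\mathfrak{b}=\bigoplus_{m\geq 0}(\mathbb{C}L_m\oplus\mathbb{C}G_m)\oplus\mathbb{C}c$, and assume that there exists $t\in\mathbb{Z}_+$ such that (1) the action of $L_t$ on $V$ is injective and (2) $L_iV=0$ for all $i>t$. Then the induced module $\mathrm{Ind}(V)=U(\mathcal{R})\otimes_{U(\mathfrak{b})}V$ is a simple smooth $\mathcal{R}$-module.
   Context: The Ramond algebra $\mathcal{R}=\mathcal{R}_{\bar 0}\oplus\mathcal{R}_{\bar 1}$ is the Lie superalgebra with basis $\{L_m,G_m,c\mid m\in\mathbb{Z}\}$, where $\mathcal{R}_{\bar 0}=\mathrm{span}\{L_m,c\}$, $\mathcal{R}_{\bar 1}=\mathrm{span}\{G_m\}$, and brackets $[L_m,L_n]=(m-n)L_{m+n}+\delta_{m+n,0}\frac{m^3-m}{12}c$, $[L_m,G_n]=(\frac m2-n)G_{m+n}$, $[G_m,G_n]=2L_{m+n}+\frac13\delta_{m+n,0}(m^2-\frac14)c$, $[\mathcal{R},c]=0$. Modules are $\mathbb{Z}_2$-graded (super)modules; simple means no nonzero proper graded submodules. For $m\in\mathbb{Z}$ let $\mathcal{R}_m=\mathrm{span}\{L_m,G_m,\delta_{m,0}c\}$. An $\mathcal{R}$-module $M$ is smooth if for every $v\in M$ there exists $n\in\mathbb{N}$ with $\mathcal{R}_mv=0$ for all $m>n$. *)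

(* Defs.v *)
From HB Require Import structures.
From mathcomp Require Import all_boot all_order all_algebra.
From mathcomp Require Import reals complex.
Set Implicit Arguments. Unset Strict Implicit. Unset Printing Implicit Defensive.
Import Order.TTheory GRing.Theory Num.Theory.
Local Open Scope ring_scope.

Inductive Rgen := RL of int | RG of int | Rc.

Definition Rodd (x : Rgen) : bool := if x is RG _ then true else false.

Definition Rall : Rgen -> bool := fun _ => true.
Definition Rb (x : Rgen) : bool :=
  match x with RL m => (0 <= m)%R | RG m => (0 <= m)%R | Rc => true end.

Section RamondModules.
Variable R : realType.
Local Notation C := (R[i]).

(* A Z2-graded (super) vector space is an lmodType M together with the
   projection pi onto the even part M_0 along the odd part M_1
   (pi linear and idempotent). [act x] is the action of the basis element x.
   [is_smod S M pi act] : (M, pi, act) is a supermodule over the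
   sub-superalgebra spanned by the generators in S (S = Rall or S = Rb;
   both are closed under the bracket). Only the action of the generators
   in S matters. *)
Definition is_smod (S : Rgen -> bool) (M : lmodType C) (pi : M -> M)
    (act : Rgen -> M -> M) : Prop :=
  [/\ (forall (a : C) (u v : M), pi (a *: u + v) = a *: pi u + pi v),
      (forall v, pi (pi v) = pi v),
      (forall x, S x -> forall (a : C) (u v : M),
          act x (a *: u + v) = a *: act x u + act x v),
      (forall x, S x -> forall v,
          if Rodd x then pi (act x v) = act x (v - pi v)
          else pi (act x v) = act x (pi v)) &
      [/\ (forall m n : int, S (RL m) -> S (RL n) -> forall v,
            act (RL m) (act (RL n) v) - act (RL n) (act (RL m) v) =
            (m - n)%:~R *: act (RL (m + n)) v +
            (if m + n == 0 then ((m ^+ 3 - m)%:~R / 12%:R) *: act Rc v else 0)),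
          (forall m n : int, S (RL m) -> S (RG n) -> forall v,
            act (RL m) (act (RG n) v) - act (RG n) (act (RL m) v) =
            (m%:~R / 2%:R - n%:~R) *: act (RG (m + n)) v),
          (forall m n : int, S (RG m) -> S (RG n) -> forall v,
            act (RG m) (act (RG n) v) + act (RG n) (act (RG m) v) =
            2%:R *: act (RL (m + n)) v +
            (if m + n == 0 then ((3%:R)^-1 * ((m ^+ 2)%:~R - 4%:R^-1)) *: act Rc v
             else 0)) &
          (S Rc -> forall x, S x -> forall v,
            act Rc (act x v) = act x (act Rc v))]].

Definition is_shom (S : Rgen -> bool) (M N : lmodType C)
    (piM : M -> M) (actM : Rgen -> M -> M) (piN : N -> N) (actN : Rgen -> N -> N)
    (f : M -> N) : Prop :=
  [/\ (forall (a : C) (u v : M), f (a *: u + v) = a *: f u + f v),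
      (forall v, f (piM v) = piN (f v)) &
      (forall x, S x -> forall v, f (actM x v) = actN x (f v))].

Definition is_gsubmod (S : Rgen -> bool) (M : lmodType C) (pi : M -> M)
    (act : Rgen -> M -> M) (W : M -> Prop) : Prop :=
  [/\ W 0,
      (forall (a : C) u v, W u -> W v -> W (a *: u + v)),
      (forall v, W v -> W (pi v)) &
      (forall x, S x -> forall v, W v -> W (act x v))].

Definition is_simple (S : Rgen -> bool) (M : lmodType C) (pi : M -> M)
    (act : Rgen -> M -> M) : Prop :=
  (exists v : M, v != 0) /\
  forall W : M -> Prop, is_gsubmod S pi act W ->
    (forall v, W v -> v = 0) \/ (forall v, W v).

(* Smooth R-module: every v is killed by R_m = span{L_m, G_m} for m >> 0
   (for m > n >= 0, R_m contains no c). *)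
Definition is_smooth (M : lmodType C) (act : Rgen -> M -> M) : Prop :=
  forall v : M, exists n : nat, forall m : int, (n%:Z < m)%R ->
    act (RL m) v = 0 /\ act (RG m) v = 0.

(* (M, piM, actM, iota) is the induced module Ind(V) = U(R) (x)_{U(b)} V,
   characterized by its universal property (Frobenius reciprocity): M is an
   R-supermodule, iota : V -> M is an even b-module homomorphism, and every
   even b-homomorphism f from V into an R-supermodule N factors uniquely
   through iota via an even R-homomorphism. *)
Definition is_induced (V : lmodType C) (piV : V -> V) (actV : Rgen -> V -> V)
    (M : lmodType C) (piM : M -> M) (actM : Rgen -> M -> M) (iota : V -> M) : Prop :=
  [/\ is_smod Rall piM actM,
      is_shom Rb piV actV piM actM iota &
      forall (N : lmodType C) (piN : N -> N) (actN : Rgen -> N -> N),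
        is_smod Rall piN actN ->
        forall f : V -> N, is_shom Rb piV actV piN actN f ->
        exists g : M -> N,
          [/\ is_shom Rall piM actM piN actN g,
              (forall v, g (iota v) = f v) &
              (forall g' : M -> N, is_shom Rall piM actM piN actN g' ->
                 (forall v, g' (iota v) = f v) -> forall x, g' x = g x)]].

End RamondModules.

(* Main.v *)
Require Import Defs.
From HB Require Import structures.
From mathcomp Require Import all_boot all_order all_algebra.
From mathcomp Require Import boolp functions.
From mathcomp Require Import reals complex.
From mathcomp Require Import ring zify.
Set Implicit Arguments. Unset Strict Implicit. Unset Printing Implicit Defensive.
Import Order.TTheory GRing.Theory Num.Theory.
Local Open Scope ring_scope.

(* Write n_- for the span of the L_m, G_m with m < 0. Every element of the induced
   module M is a sum of words in n_- applied to the image of V.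

   M is nonzero, without PBW: Hom(U(b), V) is an R-module. Indeed R = n_- + b acts
   on U(b) from the right by u . x = p(ad(u_(1)) x) u_(2), where p is the projection
   to b along n_-; that this is an action only uses that n_- is a subalgebra. The
   map v |-> (u |-> u v) is an injective b-homomorphism from V to Hom(U(b), V), and
   it factors through M, so V embeds into M.

   Simplicity: order words lexicographically by weight and length. Modulo lower
   terms the letters supercommute, so an element of M has a leading part
   sum_u u phi(u) with phi supersymmetric. For a letter x of index -n let x' be the
   element of index t + n and of the same parity. Then x' lowers the weight by n and
   the length by one, and acts on leading parts as phi |-> a L_t phi(x _) with
   a <> 0, up to a term in which G_t is applied to the coefficients. As G_t^2 = 0 on
   V, applying G_t beforehand if necessary makes that term vanish. Since L_t is
   injective, iterating leads from any nonzero element of a submodule to a nonzero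
   element of V in it, and V is simple. *)

(** * Structure constants *)

(** The generator that carries the non-central part of a bracket. Letting [Rc] be neutral makes the
    operation total, associative and commutative, and additive on indices and parities. *)
Definition gadd (x y : Rgen) : Rgen :=
  match x, y with
  | RL m, RL n => RL (m + n)
  | RL m, RG n => RG (m + n)
  | RG m, RL n => RG (m + n)
  | RG m, RG n => RL (m + n)
  | Rc, z => z
  | z, Rc => z
  end.

Definition gidx (x : Rgen) : int :=
  match x with RL m => m | RG m => m | Rc => 0 end.

Lemma gaddA x y z : gadd x (gadd y z) = gadd (gadd x y) z.
Proof. by case: x y z => [m|m|] [n|n|] [k|k|] //=; rewrite addrA. Qed.

Lemma gaddC x y : gadd x y = gadd y x.
Proof. by case: x y => [m|m|] [n|n|] //=; rewrite addrC. Qed.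

Lemma gidxD x y : gidx (gadd x y) = gidx x + gidx y.
Proof. by case: x y => [m|m|] [n|n|] //=; rewrite ?addr0 ?add0r. Qed.

Lemma RoddD x y : Rodd (gadd x y) = Rodd x (+) Rodd y.
Proof. by case: x y => [m|m|] [n|n|]. Qed.

Lemma RbE x : Rb x = (0 <= gidx x).
Proof. by case: x. Qed.

Lemma RbD x y : Rb x -> Rb y -> Rb (gadd x y).
Proof. by rewrite !RbE gidxD; apply: addr_ge0. Qed.

Section StructureConstants.
Variable R : realType.
Local Notation C := (R[i]).

(* [x, y] = gco x y * gadd x y + gce x y * c *)
Definition gco (x y : Rgen) : C :=
  match x, y with
  | RL m, RL n => (m - n)%:~R
  | RL m, RG n => m%:~R / 2%:R - n%:~R
  | RG m, RL n => m%:~R - n%:~R / 2%:R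
  | RG m, RG n => 2%:R
  | _, _ => 0
  end.

Definition gce (x y : Rgen) : C :=
  match x, y with
  | RL m, RL n => if m + n == 0 then (m ^+ 3 - m)%:~R / 12%:R else 0
  | RG m, RG n =>
      if m + n == 0 then (3%:R)^-1 * ((m ^+ 2)%:~R - 4%:R^-1) else 0
  | _, _ => 0
  end.

Definition gsgn (x y : Rgen) : C := (-1) ^+ (Rodd x && Rodd y).

Lemma gsgnDl x y z : gsgn (gadd x y) z = gsgn x z * gsgn y z.
Proof. by rewrite /gsgn RoddD -signr_addb andb_addl. Qed.

Lemma gsgnC x y : gsgn x y = gsgn y x.
Proof. by rewrite /gsgn andbC. Qed.

Lemma gsgnDr x y z : gsgn z (gadd x y) = gsgn z x * gsgn z y.
Proof. by rewrite gsgnC gsgnDl !(gsgnC z). Qed.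

Lemma gsgn2 x y : gsgn x y * gsgn x y = 1.
Proof. by rewrite /gsgn -signr_addb addbb. Qed.

Lemma gsgncr x : gsgn x Rc = 1. Proof. by rewrite gsgnC. Qed.

Lemma gcoC x y : gco x y = - gsgn x y * gco y x.
Proof.
by case: x y => [m|m|] [n|n|]; rewrite /gsgn /= ?rmorphB /=; ring.
Qed.

Lemma gceC x y : gce x y = - gsgn x y * gce y x.
Proof.
case: x y => [m|m|] [n|n|]; rewrite /gsgn /=; try ring.
- rewrite [n + m]addrC; case: eqP => [e|_]; last by ring.
  have -> : n = - m by lia.
  by rewrite !(rmorphB, rmorphXn, rmorphN) /=; field.
- rewrite [n + m]addrC; case: eqP => [e|_]; last by ring.
  have -> : n = - m by lia.
  by rewrite !(rmorphB, rmorphXn, rmorphN) /=; field.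
Qed.

Lemma gco_jacobi g x y :
  gco x y * gco g (gadd x y) =
  gco g x * gco (gadd g x) y + gsgn g x * gco g y * gco x (gadd g y).
Proof.
case: g x y => [k|k|] [m|m|] [n|n|];
  rewrite /gsgn /= ?(rmorphB, rmorphD) /=; by [ring | field].
Qed.

(** Central coefficient of the super Jacobi identity. It vanishes unless the indices sum to zero;
    eliminating one index then leaves a polynomial identity in the other two. *)
Lemma gce_jacobi g x y :
  gco x y * gce g (gadd x y) =
  gco g x * gce (gadd g x) y + gsgn g x * gco g y * gce x (gadd g y).
Proof.
case: g x y => [k|k|] [m|m|] [n|n|]; rewrite /gsgn /=; try ring.
all: rewrite -?[k + m + n]addrA ?[m + (k + n)]addrCA; case: eqP => [e|_]; last by ring.
all: have -> : k = - (m + n) by lia.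
all: rewrite !(rmorphB, rmorphXn, rmorphN, rmorphD) /=; by field.
Qed.

Lemma gco_cr x : gco x Rc = 0. Proof. by case: x. Qed.
Lemma gce_cr x : gce x Rc = 0. Proof. by case: x. Qed.

Lemma gce_neq0 x y : gidx x + gidx y != 0 -> gce x y = 0.
Proof. by case: x y => [m|m|] [n|n|] //= /negPf ->. Qed.

Lemma gce_odd x y : Rodd x != Rodd y -> gce x y = 0.
Proof. by case: x y => [m|m|] [n|n|]. Qed.

End StructureConstants.

(* The value at [x, y] of the linear extension of h. *)
HB.lock Definition lbr (R : realType) (U : lmodType R[i]) (h : Rgen -> U)
    (x y : Rgen) : U :=
  gco R x y *: h (gadd x y) + gce R x y *: h Rc.

Section Bracket.
Variable R : realType.
Local Notation C := (R[i]).
Local Notation gco := (gco R).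
Local Notation gce := (gce R).
Local Notation gsgn := (gsgn R).

Section LinearBracket.
Variable U : lmodType C.
Implicit Types h : Rgen -> U.

Lemma lbrE h x y : lbr h x y = gco x y *: h (gadd x y) + gce x y *: h Rc.
Proof. by rewrite lbr.unlock. Qed.

Lemma eq_lbr h h' x y : h =1 h' -> lbr h x y = lbr h' x y.
Proof. by move=> e; rewrite !lbrE !e. Qed.

Lemma eq_lbr_b h h' x y : Rb x -> Rb y ->
  (forall z, Rb z -> h z = h' z) -> lbr h x y = lbr h' x y.
Proof. by move=> bx b_y e; rewrite !lbrE !e //; apply: RbD. Qed.

Lemma lbrC h x y : lbr h x y = - gsgn x y *: lbr h y x.
Proof. by rewrite !lbrE gcoC gceC gaddC scalerDr !scalerA. Qed.

Lemma lbr_cr h x : lbr h x Rc = 0.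
Proof. by rewrite !lbrE gco_cr gce_cr !scale0r addr0. Qed.

Lemma lbr_cl h x : lbr h Rc x = 0.
Proof. by rewrite lbrC lbr_cr scaler0. Qed.

Lemma lbr_lin (a : C) h h' x y :
  lbr (fun z => a *: h z + h' z) x y = a *: lbr h x y + lbr h' x y.
Proof.
by rewrite !lbrE !scalerDr !scalerA ![_ * a]mulrC -!addrA; congr (_ + _); rewrite addrCA.
Qed.

(** Super Jacobi for linear extensions: the left side is [h] at [g, [x, y]]. Brackets with the
    central terms drop out, and the rest is [gco_jacobi] and [gce_jacobi]. *)
Lemma lbr_jacobi h g x y :
  lbr (lbr h g) x y =
  lbr (fun z => lbr h z y) g x + gsgn g x *: lbr (fun z => lbr h x z) g y.
Proof.
rewrite [LHS]lbrE lbr_cr scaler0 addr0.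
rewrite [X in X + _]lbrE /= lbr_cl scaler0 addr0.
rewrite [X in _ + _ *: X]lbrE /= lbr_cr scaler0 addr0.
rewrite !lbrE !scalerDr !scalerA gco_jacobi gce_jacobi !scalerDl.
rewrite [gadd x (gadd g y)]gaddA [gadd x g]gaddC gaddA.
by rewrite addrACA -!mulrA.
Qed.

Lemma lbr_lin2 (a b : C) h h' x y :
  lbr (fun z => a *: h z + b *: h' z) x y = a *: lbr h x y + b *: lbr h' x y.
Proof.
by rewrite !lbrE !scalerDr !scalerA ![_ * a]mulrC ![_ * b]mulrC addrACA.
Qed.

Lemma lbrD h h' x y : lbr (fun z => h z + h' z) x y = lbr h x y + lbr h' x y.
Proof. by rewrite !lbrE !scalerDr addrACA. Qed.

Lemma lbrZ (a : C) h x y : lbr (fun z => a *: h z) x y = a *: lbr h x y.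
Proof. by rewrite !lbrE !scalerDr !scalerA ![_ * a]mulrC. Qed.

(** The bracket is even: its central term occurs only for arguments of equal parity, where the two
    signs cancel. *)
Lemma lbr_sgn g h x y :
  lbr (fun z => gsgn g z *: h z) x y = (gsgn g x * gsgn g y) *: lbr h x y.
Proof.
rewrite !lbrE gsgnDr !scalerDr !scalerA gsgncr ![_ * (_ * _)]mulrC mulr1.
congr (_ + _); have [e|/gce_odd ->] := eqVneq (Rodd x) (Rodd y).
  by rewrite /gsgn e -signr_addb addbb mul1r.
by rewrite mulr0 !scale0r.
Qed.

Lemma lbr_sgnr g h x y :
  lbr (fun z => gsgn z g *: h z) x y = (gsgn x g * gsgn y g) *: lbr h x y.
Proof.
by rewrite ![gsgn _ g]gsgnC -lbr_sgn; apply: eq_lbr => z; rewrite gsgnC.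
Qed.

End LinearBracket.

(** One signed relation in place of the four families, to avoid case distinctions on parity. *)
Definition smod_rel (S : Rgen -> bool) (M : lmodType C) (act : Rgen -> M -> M) :=
  forall x y, S x -> S y -> forall v,
    act x (act y v) - gsgn x y *: act y (act x v) = lbr (act^~ v) x y.

Lemma smod_relP (S : Rgen -> bool) (M : lmodType C) (act : Rgen -> M -> M) :
  S Rc -> smod_rel S act <->
  [/\ (forall m n : int, S (RL m) -> S (RL n) -> forall v,
            act (RL m) (act (RL n) v) - act (RL n) (act (RL m) v) =
            (m - n)%:~R *: act (RL (m + n)) v +
            (if m + n == 0 then ((m ^+ 3 - m)%:~R / 12%:R) *: act Rc v else 0)),
          (forall m n : int, S (RL m) -> S (RG n) -> forall v,
            act (RL m) (act (RG n) v) - act (RG n) (act (RL m) v) =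
            (m%:~R / 2%:R - n%:~R) *: act (RG (m + n)) v),
          (forall m n : int, S (RG m) -> S (RG n) -> forall v,
            act (RG m) (act (RG n) v) + act (RG n) (act (RG m) v) =
            2%:R *: act (RL (m + n)) v +
            (if m + n == 0 then ((3%:R)^-1 * ((m ^+ 2)%:~R - 4%:R^-1)) *: act Rc v
             else 0)) &
          (S Rc -> forall x, S x -> forall v,
            act Rc (act x v) = act x (act Rc v))].
Proof.
move=> Sc; split=> [H|[H1 H2 H3 H4]].
  split=> [m n Sm Sn v|m n Sm Sn v|m n Sm Sn v|_ x Sx v].
  - by have := H _ _ Sm Sn v; rewrite scale1r lbrE /= => ->; case: ifP; rewrite ?scale0r.
  - by have := H _ _ Sm Sn v; rewrite scale1r lbrE /= scale0r addr0.
  - have := H _ _ Sm Sn v; rewrite scaleN1r opprK lbrE /= => ->.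
    by case: ifP; rewrite ?scale0r.
  - by have := H _ _ Sc Sx v; rewrite lbr_cl scale1r => /subr0_eq.
move=> [m|m|] [n|n|] Sx Sy v; rewrite ?lbr_cr ?lbr_cl ?scale1r.
- by rewrite H1 // lbrE /=; case: ifP; rewrite ?scale0r.
- by rewrite H2 // lbrE /= scale0r addr0.
- by rewrite H4 // subrr.
- by rewrite lbrC lbrE /= scale0r addr0 -H2 // scaleN1r opprB.
- by rewrite scaleN1r opprK H3 // lbrE /=; case: ifP; rewrite ?scale0r.
- by rewrite H4 // subrr.
- by rewrite -H4 // subrr.
- by rewrite -H4 // subrr.
- by rewrite subrr.
Qed.

(** * The coinduced module *)

Section Transport.
Variable U : lmodType C.
Implicit Types (F : Rgen -> seq Rgen -> U) (u w A B : seq Rgen).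

(* The right action of g on functionals on R (x) T(b), dual to the left action
   g (X (x) w) = [g, X] (x) w + (-1)^{|g||X|} X (x) g w. *)
Definition step (g : Rgen) F (X : Rgen) w : U :=
  lbr (F^~ w) g X + gsgn g X *: F X (g :: w).

(** [tr u F X w] is the value of [F] at u . (X (x) w), the first letter of [u] acting last. *)
Fixpoint tr u F : Rgen -> seq Rgen -> U :=
  if u is g :: u' then tr u' (step g F) else F.

Lemma tr_cat u u' F : tr (u ++ u') F = tr u' (tr u F).
Proof. by elim: u F => //= g u IH F; rewrite IH. Qed.

Lemma eq_tr_b u F F' X w : all Rb u -> all Rb w ->
  (forall Y w', all Rb w' -> F Y w' = F' Y w') -> tr u F X w = tr u F' X w.
Proof.
elim: u F F' X w => [|g u IH] F F' X w /=; first by move=> _ bw ->.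
case/andP=> bg bu bw e; apply: IH => // Y w' bw'; rewrite /step e /= ?bg //.
by congr (_ + _); apply: eq_lbr => z; apply: e.
Qed.

Lemma tr_lin2 u (a b : C) F F' X w :
  tr u (fun X w => a *: F X w + b *: F' X w) X w = a *: tr u F X w + b *: tr u F' X w.
Proof.
elim: u F F' X w => //= g u IH F F' X w; rewrite -IH; congr (tr u _ _ _).
apply: funext => Y; apply: funext => w'.
rewrite /step lbr_lin2 !scalerDr !scalerA ![gsgn _ _ * _]mulrC.
by rewrite addrACA.
Qed.

Lemma tr_lbr u (F : Rgen -> Rgen -> seq Rgen -> U) x y X w :
  tr u (fun X w => lbr (fun z => F z X w) x y) X w = lbr (fun z => tr u (F z) X w) x y.
Proof.
rewrite lbrE -tr_lin2; congr (tr u _ _ _).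
by apply: funext => Y; apply: funext => w'; rewrite lbrE.
Qed.

(** The functionals on R (x) T(b) that descend to R (x) U(b). *)
Definition relF F := forall X A B g g', Rb g -> Rb g' ->
  F X (A ++ [:: g, g' & B]) - gsgn g g' *: F X (A ++ [:: g', g & B]) =
  lbr (fun z => F X (A ++ z :: B)) g g'.

Lemma relF_step g F : relF F -> relF (step g F).
Proof.
move=> rF X A B h h' bh bh'; rewrite /step lbrD lbrZ -(rF X (g :: A) B h h') //=.
have -> : lbr (fun z => lbr (F^~ (A ++ z :: B)) g X) h h' =
    lbr (fun Y => lbr (fun z => F Y (A ++ z :: B)) h h') g X.
  rewrite !lbrE !scalerDr !scalerA ![gco h _ * _]mulrC ![gce h _ * _]mulrC.
  by rewrite addrACA.
under [in RHS]eq_lbr => Y do rewrite -rF // -scaleN1r scalerA -[F Y _]scale1r.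
rewrite lbr_lin2 scale1r mulN1r scaleNr !scalerDr !scalerN !scalerA opprD.
by rewrite [gsgn g X * _]mulrC addrACA.
Qed.

Lemma relF_tr u F : relF F -> relF (tr u F).
Proof. by elim: u F => //= g u IH F rF; apply/IH/relF_step. Qed.

(** Dual form of the fact that b acts on R (x) U(b): the Jacobi identity handles the first factor,
    [relF] the second, and the cross terms cancel. *)
Lemma step_comm F g g' X w : relF F -> Rb g -> Rb g' ->
  step g' (step g F) X w - gsgn g g' *: step g (step g' F) X w =
  lbr (fun z => step z F X w) g g'.
Proof.
move=> rF bg bg'; have E h h' : lbr (fun z => step h F z w) h' X =
    lbr (lbr (F^~ w) h) h' X + (gsgn h h' * gsgn h X) *: lbr (F^~ (h :: w)) h' X.
  by rewrite lbrD lbr_sgn.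
rewrite [step g' _ _ _]/step [step g (step _ _) _ _]/step !E.
rewrite (lbrD (fun z => lbr (F^~ w) z X)) lbr_sgnr -(rF X [::]) //= /step lbr_jacobi.
rewrite [gsgn g' g]gsgnC !scalerDr scalerN !scalerA !mulrA gsgn2 mul1r.
rewrite [gsgn g' X * gsgn g X]mulrC [gsgn g X * gsgn g' X * _]mulrC mulrA.
set P := lbr (fun z => _) g g'; set Q := _ *: lbr _ g X.
rewrite [P + Q + _ + _](AC (3*2) ((2*3*4)*(1*5))) [Q + _ + _](AC (2*2) ((1*3*2)*4)).
by rewrite opprD addrACA subrr add0r addrA.
Qed.

End Transport.
End Bracket.

(** * Functionals with two arguments in the algebra *)

Section Transport2.
Variables (R : realType) (U : lmodType R[i]).
Local Notation C := (R[i]).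
Local Notation gsgn := (gsgn R).
Implicit Types (G : Rgen -> Rgen -> seq Rgen -> U) (u w A B : seq Rgen).

(** Dual of the diagonal action of g on R (x) R (x) T(b). *)
Definition step2 (g : Rgen) G (X Y : Rgen) w : U :=
  lbr (fun z => G z Y w) g X + gsgn g X *: lbr (fun z => G X z w) g Y
  + (gsgn g X * gsgn g Y) *: G X Y (g :: w).

Fixpoint tr2 u G : Rgen -> Rgen -> seq Rgen -> U :=
  if u is g :: u' then tr2 u' (step2 g G) else G.

Lemma eq_tr2_b u G G' X Y w : all Rb u -> all Rb w ->
  (forall X Y w', all Rb w' -> G X Y w' = G' X Y w') -> tr2 u G X Y w = tr2 u G' X Y w.
Proof.
elim: u G G' X Y w => [|g u IH] G G' X Y w /=; first by move=> _ bw ->.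
case/andP=> bg bu bw e; apply: IH => // {}X {}Y w' bw'; rewrite /step2 e /= ?bg //.
by congr (_ + _ *: _ + _); apply: eq_lbr => z; apply: e.
Qed.

Lemma tr2_lin2 u (a b : C) G G' X Y w :
  tr2 u (fun X Y w => a *: G X Y w + b *: G' X Y w) X Y w =
  a *: tr2 u G X Y w + b *: tr2 u G' X Y w.
Proof.
elim: u G G' X Y w => //= g u IH G G' X Y w; rewrite -IH; congr (tr2 u _ _ _).
apply: funext => Z; apply: funext => Z'; apply: funext => w'.
rewrite /step2 !lbr_lin2 !scalerDr !scalerA ![a * _]mulrC ![b * _]mulrC.
by rewrite (AC (2*2*2) ((1*3*5)*(2*4*6))).
Qed.

Lemma tr2_swap u G X Y w :
  tr2 u (fun X Y w => gsgn X Y *: G Y X w) X Y w = gsgn X Y *: tr2 u G Y X w.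
Proof.
elim: u G X Y w => //= g u IH G X Y w; rewrite -IH; congr (tr2 u _ _ _).
apply: funext => Z; apply: funext => Z'; apply: funext => w'.
rewrite /step2 lbr_sgn lbr_sgnr !scalerDr !scalerA; congr (_ + _ *: _); last by ring.
by rewrite [gsgn Z g]gsgnC mulrA gsgn2 mul1r mulrC [RHS]addrC.
Qed.

(** Equivariance of the bracket R (x) R -> R, which is the Jacobi identity. *)
Lemma tr2_lbr u (F : Rgen -> seq Rgen -> U) X Y w :
  lbr (fun z => tr u F z w) X Y = tr2 u (fun X Y w => lbr (F^~ w) X Y) X Y w.
Proof.
elim: u F X Y w => //= g u IH F X Y w; rewrite IH; congr (tr2 u _ _ _).
apply: funext => Z; apply: funext => Z'; apply: funext => w'.
by rewrite /step lbrD lbr_sgn lbr_jacobi.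
Qed.

(** The map X (x) w |-> X (x) w . (Y (x) 1) intertwines the actions of [u] on R (x) T(b) and on R
    (x) R (x) T(b). *)
Lemma tr_tr u (K : Rgen -> Rgen -> seq Rgen -> U) X Y w :
  tr u (fun X w => tr w (K X) Y [::]) X w = tr w (tr2 u K X) Y [::].
Proof.
elim: u K X Y w => //= g u IH K X Y w; rewrite -IH; congr (tr u _ _ _).
apply: funext => Z; apply: funext => w'.
rewrite {1}/step -tr_lbr /= -[X in X + _]scale1r -tr_lin2.
congr (tr w' _ _ _); apply: funext => Z'; apply: funext => w''.
by rewrite scale1r /step /step2 scalerDr scalerA addrA.
Qed.

Definition wodd (u : seq Rgen) : bool := foldr (fun z b => Rodd z (+) b) false u.

Lemma wodd_cat u u' : wodd (u ++ u') = wodd u (+) wodd u'.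
Proof. by elim: u => //= z u ->; rewrite addbA. Qed.

(** The action preserves total parity, so a linear map selected by that parity can be pulled out
    once the parity of [u] is counted in. *)
Lemma tr_map (p : bool -> U -> U) (s : bool) u (F F' : Rgen -> seq Rgen -> U) X w :
  (forall b (a : C) v v', p b (a *: v + v') = a *: p b v + p b v') ->
  (forall X w, F' X w = p (s (+) Rodd X (+) wodd w) (F X w)) ->
  tr u F' X w = p (s (+) wodd u (+) Rodd X (+) wodd w) (tr u F X w).
Proof.
move=> pl; have p0 b : p b 0 = 0.
  by have := pl b (-1) 0 0; rewrite scaler0 addr0 scaleN1r addNr.
have pZ b (a : C) v : p b (a *: v) = a *: p b v.
  by rewrite -[X in p b X]addr0 pl p0 addr0.
have pD b v v' : p b (v + v') = p b v + p b v'.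
  by rewrite -[v in LHS]scale1r pl scale1r.
elim: u s F F' X w => /= [|g u IH] s F F' X w e; first by rewrite addbF.
rewrite (IH (s (+) Rodd g) (step g F)); first by rewrite !addbA.
move=> Y w' /=; rewrite /step e /= !lbrE !e !pD !pZ RoddD /= addbF.
rewrite !addbA [s (+) Rodd Y (+) Rodd g]addbAC; congr (_ + _ + _).
have [->|/gce_odd ->] := eqVneq (Rodd g) (Rodd Y); last by rewrite !scale0r.
by rewrite [s (+) _ (+) _]addbK.
Qed.

End Transport2.

(** * Functionals on U(b) with values in V *)

Section Coinduced.
Variables (R : realType) (V : lmodType R[i]) (piV : V -> V) (actV : Rgen -> V -> V).
Local Notation C := (R[i]).
Local Notation gsgn := (gsgn R).
Hypothesis HV : is_smod Rb piV actV.
Implicit Types (f : seq Rgen -> V) (u w A B : seq Rgen).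

Definition ppi b v := if b then v - piV v else piV v.

Lemma ppi_lin b (a : C) v v' : ppi b (a *: v + v') = a *: ppi b v + ppi b v'.
Proof.
case: HV => pl _ _ _ _; rewrite /ppi pl; case: b => //.
by rewrite scalerBr opprD addrACA.
Qed.

Lemma ppi0 b : ppi b 0 = 0.
Proof. by have := ppi_lin b (-1) 0 0; rewrite scaler0 addr0 scaleN1r addNr. Qed.

Lemma actV_lin x (a : C) v v' :
  Rb x -> actV x (a *: v + v') = a *: actV x v + actV x v'.
Proof. by move=> bx; case: HV => _ _ + _ _; apply. Qed.

Lemma actV_rel : smod_rel Rb actV.
Proof. by case: HV => _ _ _ _ h; apply/smod_relP. Qed.

Lemma piV_act x v : Rb x -> piV (actV x v) = actV x (ppi (Rodd x) v).
Proof. by move=> bx; case: HV => _ _ _ + _ => /(_ x bx v); rewrite /ppi; case: Rodd. Qed.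

(** The functional X (x) w |-> f(p(X) w), with p the projection onto b along n_-. *)
Definition pf f X w : V := if Rb X then f (X :: w) else 0.

(* (x f)(u) = f(u . x), where u . x is the projection to U(b) of
   sum ad(u_(1))(x) u_(2), that is, of u x modulo n_- U(R). *)
Definition cact x f u : V := if all Rb u then tr u (pf f) x [::] else 0.

(** The even part of [f]: its value on [u] has the parity of [u]. *)
Definition cpi f u : V := ppi (wodd u) (f u).

(* The functions f on words that come from a linear map U(b) -> V, extended by 0
   to the words that involve generators outside b. *)
Definition coind f : Prop :=
  (forall u, ~~ all Rb u -> f u = 0) /\
  (forall A B g g', Rb g -> Rb g' ->
    f (A ++ [:: g, g' & B]) - gsgn g g' *: f (A ++ [:: g', g & B]) =
    lbr (fun z => f (A ++ z :: B)) g g').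

Lemma relF_pf f : coind f -> relF (pf f).
Proof.
move=> [_ rf] X A B g g' bg bg'; rewrite /pf; case: ifP => bX.
  exact: (rf (X :: A)).
by rewrite scaler0 subrr lbrE !scaler0 addr0.
Qed.

Lemma coind_lin (a : C) f f' : coind f -> coind f' -> coind (fun u => a *: f u + f' u).
Proof.
move=> [s r] [s' r']; split=> [u nu|A B g g' bg bg'].
  by rewrite s // s' // scaler0 addr0.
rewrite lbr_lin -r // -r' // scalerBr scalerDr !scalerA [gsgn _ _ * a]mulrC opprD.
by rewrite addrACA.
Qed.

Lemma coind_cpi f : coind f -> coind (cpi f).
Proof.
move=> [s r]; split=> [u nu|A B g g' bg bg'].
  by rewrite /cpi s // ppi0.
rewrite /cpi !wodd_cat /= [Rodd g' (+) (_ (+) _)]addbCA.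
rewrite addrC -scaleNr -ppi_lin scaleNr addrC r // !lbrE wodd_cat /= RoddD addbA.
have ppiZ b (c : C) v : ppi b (c *: v) = c *: ppi b v.
  by rewrite -[_ *: _ in LHS]addr0 ppi_lin ppi0 addr0.
rewrite ppi_lin ppiZ; congr (_ + _).
  by rewrite !addbA.
have [e|/gce_odd ->] := eqVneq (Rodd g) (Rodd g'); last by rewrite !scale0r.
by rewrite wodd_cat e /= -!addbA [Rodd g' (+) (Rodd g' (+) _)]addbA addbb.
Qed.

(** In U(b) one has [g, X] w + (-1)^{|g||X|} X g w = g X w, so multiplication turns the diagonal
    action on b (x) U(b) into left multiplication. *)
Lemma tr_eq u A F f x w : coind f -> Rb x -> all Rb u ->
  (forall X w, Rb X -> F X w = f (A ++ X :: w)) -> tr u F x w = f (A ++ u ++ x :: w).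
Proof.
move=> [_ rf] bx; elim: u A F => [|g u IH] A F /=; first by move=> _ ->.
case/andP=> bg bu e; rewrite (IH (A ++ [:: g])) // -?catA // => X w' bX.
rewrite /step e // (@eq_lbr_b _ _ _ (fun z => f (A ++ z :: w'))) // => [|z bz]; last exact: e.
by rewrite -rf // subrK -catA.
Qed.

Lemma cact_b f x u : coind f -> Rb x -> all Rb u -> cact x f u = f (rcons u x).
Proof.
move=> cf bx bu; rewrite /cact bu (@tr_eq _ [::] _ f) ?cats1 // => X w bX.
by rewrite /pf bX.
Qed.

(** Adjacent letters of the argument act by consecutive steps, so [step_comm] yields the relations
    of U(b). *)
Lemma coind_cact f x : coind f -> coind (cact x f).
Proof.
move=> cf; split=> [u nu|A B g g' bg bg']; first by rewrite /cact (negPf nu).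
rewrite /cact; have E z : Rb z -> all Rb (A ++ z :: B) = all Rb A && all Rb B.
  by move=> bz; rewrite all_cat /= bz.
rewrite (@eq_lbr_b _ _ _ (fun z => if all Rb A && all Rb B then
    tr (A ++ z :: B) (pf f) x [::] else 0)) //; last by move=> z bz; rewrite E.
rewrite !all_cat /= bg bg' /=; case: ifP => _; last first.
  by rewrite scaler0 subrr lbrE !scaler0 addr0.
rewrite !tr_cat /=; under eq_lbr => z do rewrite tr_cat /=.
rewrite -tr_lbr -[X in X - _]scale1r -scaleNr -tr_lin2.
congr (tr B _ _ _); apply: funext => X; apply: funext => w.
rewrite scale1r scaleNr; apply: step_comm => //.
exact/relF_tr/relF_pf.
Qed.

Lemma cact_lin x (a : C) f f' u :
  cact x (fun u => a *: f u + f' u) u = a *: cact x f u + cact x f' u.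
Proof.
rewrite /cact; case: ifP => _; last by rewrite scaler0 addr0.
rewrite -[X in _ + X]scale1r -tr_lin2; congr (tr u _ _ _).
apply: funext => X; apply: funext => w; rewrite /pf; case: ifP => _.
  by rewrite scale1r.
by rewrite !scaler0 addr0.
Qed.

Lemma cpi_cact x f u : cpi (cact x f) u = cact x (fun u => ppi (Rodd x (+) wodd u) (f u)) u.
Proof.
rewrite /cpi /cact; case: ifP => _; last exact: ppi0.
rewrite [RHS](@tr_map _ _ ppi (Rodd x) u (pf f)) /=.
  by rewrite addbF addbAC addbb.
  exact: ppi_lin.
by move=> X w; rewrite /pf; case: ifP => _; rewrite /= ?ppi0 // addbA.
Qed.

(** By [tr_tr], [tr2_swap] and [tr2_lbr] every term is a transport along [u] of a functional on R
    (x) R (x) T(b), which reduces the claim to an identity between these functionals. *)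
Lemma cact_rel f x y u : coind f ->
  cact x (cact y f) u - gsgn x y *: cact y (cact x f) u = lbr (fun z => cact z f u) x y.
Proof.
move=> cf; rewrite /cact; case: ifP => bu; last first.
  by rewrite scaler0 subrr lbrE !scaler0 addr0.
(* [K X] is the functional [pf f] composed with the action of p(X). *)
pose K X : Rgen -> seq Rgen -> V := if Rb X then step X (pf f) else fun _ _ => 0.
have tr0 u' X w : tr u' (fun _ _ => 0 : V) X w = 0.
  elim: u' => //= g u' IH; rewrite -[RHS]IH; congr (tr u' _ _ _).
  by apply: funext => ?; apply: funext => ?; rewrite /step lbrE !scaler0 !addr0.
have E z z' : tr u (pf (cact z f)) z' [::] = tr2 u K z' z [::].
  rewrite -[RHS]/(tr [::] (tr2 u K z') z [::]) -tr_tr.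
  apply: eq_tr_b => // Y w bw; rewrite /pf /cact /K; case: ifP => bY.
    by rewrite /= bY bw.
  by rewrite tr0.
rewrite !E tr2_lbr -tr2_swap -[X in X - _]scale1r -scaleN1r -tr2_lin2.
apply: eq_tr2_b => // X Y w bw; rewrite scale1r scaleN1r.
(* With both letters in b this is the relation in U(b); with one in b, a single term survives on the
   left; with both in n_-, everything vanishes because n_- is closed under the bracket. *)
rewrite /K; case: (boolP (Rb X)) => bX; case: (boolP (Rb Y)) => bY; rewrite /step.
- rewrite (lbrC _ Y X) {2 4}/pf bX bY [gsgn Y X]gsgnC scalerDr !scalerA gsgn2 scale1r.
  rewrite mulrN gsgn2 scaleN1r opprD opprK.
  rewrite addrACA addrC -(opprB (f _)) -(_ : lbr (pf f^~ w) X Y =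
    f [:: X, Y & w] - gsgn X Y *: f [:: Y, X & w]).
    by rewrite addKr.
  case: cf => _ rf; rewrite (rf [::]) //; apply: eq_lbr_b => // z bz.
  by rewrite /pf bz.
- by rewrite {2}/pf (negPf bY) !scaler0 oppr0 !addr0.
- rewrite {2}/pf (negPf bX) add0r scaler0 addr0 (lbrC _ Y X) scalerA.
  by rewrite mulrN [gsgn Y X]gsgnC gsgn2 scaleN1r opprK.
- rewrite scaler0 subr0 lbrE /pf.
  have iX : gidx X < 0 by rewrite ltNge -RbE.
  have iY : gidx Y < 0 by rewrite ltNge -RbE.
  have -> : Rb (gadd X Y) = false by rewrite RbE gidxD; lia.
  by rewrite gce_neq0 ?scaler0 ?scale0r ?addr0 //; lia.
Qed.

Definition cemb (v : V) u : V := if all Rb u then foldr actV v u else 0.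

Lemma foldr_act_lin u (a : C) v v' : all Rb u ->
  foldr actV (a *: v + v') u = a *: foldr actV v u + foldr actV v' u.
Proof. by elim: u => //= x u IH /andP[bx bu]; rewrite IH // actV_lin. Qed.

Lemma cemb_lin u (a : C) v v' : cemb (a *: v + v') u = a *: cemb v u + cemb v' u.
Proof.
rewrite /cemb; case: ifP => [bu|_]; last by rewrite scaler0 addr0.
exact: foldr_act_lin.
Qed.

Lemma coind_cemb v : coind (cemb v).
Proof.
split=> [u nu|A B g g' bg bg']; first by rewrite /cemb (negPf nu).
rewrite (@eq_lbr_b _ _ _ (fun z => if all Rb A && all Rb B then
    foldr actV (actV z (foldr actV v B)) A else 0)) //; last first.
  by move=> z bz; rewrite /cemb all_cat /= bz foldr_cat.
rewrite /cemb !all_cat /= bg bg' /=; case: ifP => [/andP[bA _]|_]; last first.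
  by rewrite scaler0 subrr lbrE !scaler0 addr0.
rewrite !foldr_cat /= addrC -scaleNr -foldr_act_lin // scaleNr addrC actV_rel //.
have aZ (c : C) v' : foldr actV (c *: v') A = c *: foldr actV v' A.
  have a0 : foldr actV 0 A = 0.
    by have := foldr_act_lin (-1) 0 0 bA; rewrite scaler0 addr0 scaleN1r addNr.
  by rewrite -[_ *: _ in LHS]addr0 foldr_act_lin // a0 addr0.
by rewrite !lbrE foldr_act_lin // aZ.
Qed.

Lemma cemb_act x v u : Rb x -> cemb (actV x v) u = cact x (cemb v) u.
Proof.
move=> bx; case: (boolP (all Rb u)) => bu; last by rewrite /cemb /cact (negPf bu).
rewrite cact_b //; last exact: coind_cemb.
by rewrite /cemb all_rcons bx bu foldr_rcons.
Qed.

Lemma piV_foldr u v : all Rb u -> foldr actV (piV v) u = ppi (wodd u) (foldr actV v u).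
Proof.
elim: u => //= x u IH /andP[bx bu]; rewrite IH //.
have [_ idem _ _ _] := HV.
have aB v1 v2 : actV x (v1 - v2) = actV x v1 - actV x v2.
  by rewrite addrC -scaleN1r actV_lin // scaleN1r addrC.
set y := foldr _ _ _.
have := piV_act y bx; rewrite /ppi; case: (Rodd x); case: (wodd u) => /= ->;
  rewrite ?aB //; rewrite opprB addrC subrK //.
Qed.

Lemma cemb_pi v u : cemb (piV v) u = cpi (cemb v) u.
Proof.
rewrite /cpi /cemb; case: ifP => [bu|_]; first exact: piV_foldr.
by rewrite ppi0.
Qed.

End Coinduced.

(** * Submodules and the universal property *)

Section SubLmodule.
Variables (R : realType) (M : lmodType R[i]) (P : M -> Prop).
Local Notation C := (R[i]).
Hypothesis P0 : P 0.
Hypothesis Plin : forall (a : C) u v, P u -> P v -> P (a *: u + v).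

Let subp : {pred M} := fun x => `[< P x >].

Let subp_closed : GRing.submod_closed subp.
Proof.
split; first by rewrite unfold_in; apply/asboolP.
by move=> a u v; rewrite !unfold_in => /asboolP Pu /asboolP Pv; apply/asboolP/Plin.
Qed.

HB.instance Definition _ := GRing.isSubmodClosed.Build C M subp subp_closed.

Record submod := Submod { subval : M; _ : subval \in subp }.

HB.instance Definition _ := [isSub for subval].
HB.instance Definition _ := [Choice of submod by <:].
HB.instance Definition _ := [SubChoice_isSubLmodule of submod by <:].

(** [k] is a total inverse of the inclusion [j], with value 0 outside [P]. *)
Lemma exists_sub_lmodType :
  exists (N : lmodType C) (j : N -> M) (k : M -> N),
  [/\ forall (a : C) u v, j (a *: u + v) = a *: j u + j v, injective j,
      forall y, P (j y) & forall x, P x -> j (k x) = x].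
Proof.
exists submod, val, (insubd 0); split=> [||[x Px]|x Px].
- exact: linearP.
- exact: val_inj.
- by have /asboolP : `[< P x >] := Px.
- by rewrite val_insubd unfold_in; case: asboolP.
Qed.

End SubLmodule.

Section SubSmod.
Variables (R : realType) (S : Rgen -> bool) (M : lmodType R[i]).
Variables (pi : M -> M) (act : Rgen -> M -> M) (P : M -> Prop).
Local Notation C := (R[i]).
Local Notation gsgn := (gsgn R).

(** The axioms are asked on [P] only: for functions on words the bracket relations are available
    under [coind]. *)
Lemma exists_sub_smod :
  S Rc ->
  P 0 ->
  (forall (a : C) u v, P u -> P v -> P (a *: u + v)) ->
  (forall v, P v -> P (pi v)) ->
  (forall x v, S x -> P v -> P (act x v)) ->
  (forall x y, S x -> S y -> S (gadd x y)) ->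
  (forall (a : C) u v, P u -> P v -> pi (a *: u + v) = a *: pi u + pi v) ->
  (forall v, P v -> pi (pi v) = pi v) ->
  (forall x, S x -> forall (a : C) u v, P u -> P v ->
     act x (a *: u + v) = a *: act x u + act x v) ->
  (forall x, S x -> forall v, P v ->
     pi (act x v) = act x (if Rodd x then v - pi v else pi v)) ->
  (forall x y, S x -> S y -> forall v, P v ->
     act x (act y v) - gsgn x y *: act y (act x v) = lbr (act^~ v) x y) ->
  exists (N : lmodType C) (piN : N -> N) (actN : Rgen -> N -> N)
    (j : N -> M) (k : M -> N),
  [/\ is_smod S piN actN, is_shom S piN actN pi act j, injective j,
      forall y, P (j y) & forall x, P x -> j (k x) = x].
Proof.
move=> Sc P0 Plin Ppi Pact SD pil pii al par rel.
have [N [j [k [jl ji Pj jk]]]] := exists_sub_lmodType P0 Plin.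
have j0 : j 0 = 0.
  by have := jl (-1) 0 0; rewrite scaler0 addr0 scaleN1r addNr.
have jZ (a : C) v : j (a *: v) = a *: j v.
  by rewrite -[_ *: _ in LHS]addr0 jl j0 addr0.
have jB u v : j (u - v) = j u - j v.
  by rewrite addrC -scaleN1r jl scaleN1r addrC.
pose piN y := k (pi (j y)); pose actN x y := k (act x (j y)).
have jpi y : j (piN y) = pi (j y) by apply/jk/Ppi.
have jact x y : S x -> j (actN x y) = act x (j y) by move=> Sx; apply/jk/Pact.
exists N, piN, actN, j, k; split=> //; split.
- by move=> a u v; apply: ji; rewrite jl !jpi jl pil.
- by move=> v; apply: ji; rewrite !jpi pii.
- by move=> x Sx a u v; apply: ji; rewrite jl !jact // jl al.
- move=> x Sx v; have := par x Sx _ (Pj v); case: ifP => _ e;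
    by apply: ji; rewrite ?jB ?jpi !jact // ?jB ?jpi.
- apply/smod_relP => // x y Sx Sy v; apply: ji.
  by rewrite jB jZ !jact // rel // !lbrE jl jZ !jact //; apply: SD.
- by [].
- by [].
- by move=> x Sx v; apply: jact.
Qed.
End SubSmod.

(** * Injectivity of [iota] and generation by its image *)

Section InducedIota.
Variables (R : realType) (V : lmodType R[i]) (piV : V -> V) (actV : Rgen -> V -> V).
Variables (M : lmodType R[i]) (piM : M -> M) (actM : Rgen -> M -> M) (iota : V -> M).
Hypothesis HV : is_smod Rb piV actV.
Hypothesis HM : is_induced piV actV piM actM iota.

Lemma iota_inj : injective iota.
Proof.
have [_ _ univ] := HM.
pose X : lmodType R[i] := seq Rgen -> V.
have [|||||||||||N [piN [actN [j [k [sN [jl jpi jact] ji Pj jk]]]]]] :=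
  @exists_sub_smod R Rall X (cpi piV) (cact (V := V)) (coind (V := V)).
- by [].
- split=> [//|A B g g' _ _]; by rewrite lbrE !scaler0 addr0 subrr.
- by move=> a u v; apply: coind_lin.
- by move=> v; apply: (coind_cpi HV).
- by move=> x v _; apply: coind_cact.
- by [].
- by move=> a u v _ _; apply: funext => w; rewrite /cpi /= (ppi_lin HV).
- move=> v _; apply: funext => w; rewrite /cpi.
  have [pl idem _ _ _] := HV.
  have pB u u' : piV (u - u') = piV u - piV u'.
    by rewrite addrC -scaleN1r pl scaleN1r addrC.
  by rewrite /ppi; case: wodd; rewrite ?pB !idem // subrr subr0.
- by move=> x _ a u v _ _; apply: funext => w; apply: cact_lin.
- move=> x _ v _; apply: funext => w; rewrite (cpi_cact HV); congr (cact _ _ _).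
  apply: funext => w'.
  have E (g h : X) : (g - h) w' = g w' - h w' by [].
  rewrite /cpi /ppi; case: (Rodd x) => //=; rewrite E; case: (wodd w') => //=.
  by rewrite opprB addrC subrK.
- move=> x y _ _ v cv; apply: funext => w.
  rewrite -[RHS]/((fun f : X => f w) (lbr (fun z => cact z v : X) x y)) lbrE.
  by have := cact_rel x y w cv; rewrite lbrE.
have fP : is_shom Rb piV actV piN actN (fun v => k (cemb actV v)).
  split.
  - move=> a u v; apply: ji; rewrite jl !jk; try exact: (coind_cemb HV).
    by apply: funext => w; apply: (cemb_lin HV).
  - move=> v; apply: ji; rewrite jpi !jk; try exact: (coind_cemb HV).
    by apply: funext => w; apply: (cemb_pi HV).
  - move=> x bx v; apply: ji; rewrite jact // !jk; try exact: (coind_cemb HV).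
    by apply: funext => w; apply: (cemb_act HV).
have [g [_ gi _]] := univ N piN actN sN _ fP.
(* Evaluation at the empty word recovers a vector from its image under [cemb]. *)
move=> u v e; have : j (g (iota u)) [::] = j (g (iota v)) [::] by rewrite e.
by rewrite !gi !jk //; apply: (coind_cemb HV).
Qed.

(** As [iota] lands in [P], it induces a map [g] from M to [P]. Both [j \o g] and the identity
    extend [iota], so they agree by uniqueness. *)
Lemma iota_span (P : M -> Prop) : is_gsubmod Rall piM actM P ->
  (forall v, P (iota v)) -> forall w, P w.
Proof.
move=> [P0 Pl Ppi Pact] Pi.
have [sM [il ipi iact] univ] := HM.
have [pl idem al par rel] := sM.
have [|||||||||||N [piN [actN [j [k [sN [jl jpi jact] ji Pj jk]]]]]] :=
  @exists_sub_smod R Rall M piM actM P.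
- by [].
- by [].
- by move=> a u v; apply: Pl.
- by move=> v; apply: Ppi.
- by move=> x v Sx Pv; apply: Pact.
- by [].
- by move=> a u v _ _; apply: pl.
- by move=> v _; apply: idem.
- by move=> x Sx a u v _ _; apply: al.
- by move=> x Sx v _; have := par x Sx v; case: ifP.
- by move/(smod_relP actM (isT : Rall Rc)): rel => rel x y Sx Sy v _; apply: rel.
have fP : is_shom Rb piV actV piN actN (fun v => k (iota v)).
  split=> [a u v|v|x bx v]; apply: ji.
  - by rewrite jl !jk // il.
  - by rewrite jpi !jk // ipi.
  - by rewrite jact // !jk // iact.
have [g [[gl gpi gact] gi _]] := univ N piN actN sN _ fP.
have [h [_ _ hu]] := univ M piM actM sM iota (And3 il ipi iact).
move=> w; have -> : w = j (g w).
  transitivity (h w); first by apply: (hu id).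
  symmetry; apply: (hu (j \o g)) => [|v] /=; last by rewrite gi jk.
  by split=> [a u v|v|x Sx v] /=; rewrite ?gl ?jl ?gpi ?jpi ?gact ?jact.
exact: Pj.
Qed.

End InducedIota.

(** * Filtration by weight and length *)

(** This code supplies decidable equality on generators. *)
Definition Rgen_code (x : Rgen) : int + int + unit :=
  match x with RL m => inl (inl m) | RG m => inl (inr m) | Rc => inr tt end.
Definition Rgen_decode (c : int + int + unit) : Rgen :=
  match c with inl (inl m) => RL m | inl (inr m) => RG m | inr _ => Rc end.
Lemma Rgen_codeK : cancel Rgen_code Rgen_decode. Proof. by case. Qed.
HB.instance Definition _ := Equality.copy Rgen (can_type Rgen_codeK).

Definition gneg (x : Rgen) : bool := gidx x < 0.

Definition wwt (u : seq Rgen) : int := foldr (fun x s => s - gidx x) 0 u.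

Lemma wwt_ge0 u : all gneg u -> 0 <= wwt u.
Proof. by elim: u => //= x u IH /andP[nx /IH]; move: nx; rewrite /gneg; lia. Qed.

Section Filtration.
Variables (R : realType) (V : lmodType R[i]) (piV : V -> V) (actV : Rgen -> V -> V).
Variables (M : lmodType R[i]) (piM : M -> M) (actM : Rgen -> M -> M) (j : V -> M).
Local Notation C := (R[i]).
Local Notation gsgn := (gsgn R).
Local Notation gco := (gco R).
Hypothesis HV : is_smod Rb piV actV.
Hypothesis HM : is_smod Rall piM actM.
Hypothesis Hj : is_shom Rb piV actV piM actM j.
Let act_lin x (a : C) (u v : M) : actM x (a *: u + v) = a *: actM x u + actM x v.
Proof. by case: HM => _ _ + _ _; apply. Qed.

Let act0 x : actM x 0 = 0.
Proof. by have := act_lin x (-1) 0 0; rewrite scaler0 addr0 scaleN1r addNr. Qed.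

Let actZ x (a : C) v : actM x (a *: v) = a *: actM x v.
Proof. by rewrite -[_ *: _ in LHS]addr0 act_lin act0 addr0. Qed.

Let actD x u v : actM x (u + v) = actM x u + actM x v.
Proof. by rewrite -[u in LHS]scale1r act_lin scale1r. Qed.

Let actB x u v : actM x (u - v) = actM x u - actM x v.
Proof. by rewrite actD -scaleN1r actZ scaleN1r. Qed.

Let act_sum x (I : Type) (r : seq I) (F : I -> M) :
  actM x (\sum_(i <- r) F i) = \sum_(i <- r) actM x (F i).
Proof.
elim: r => [|i r IH]; first by rewrite !big_nil act0.
by rewrite !big_cons actD IH.
Qed.

Let act_rel x y v : actM x (actM y v) = gsgn x y *: actM y (actM x v) + lbr (actM^~ v) x y.
Proof.
have rel : smod_rel Rall actM by case: HM => _ _ _ _ h; apply/smod_relP.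
by rewrite -rel // addrC subrK.
Qed.

Let j_lin (a : C) u v : j (a *: u + v) = a *: j u + j v.
Proof. by case: Hj. Qed.

Let j0 : j 0 = 0.
Proof. by have := j_lin (-1) 0 0; rewrite scaler0 addr0 scaleN1r addNr. Qed.

Let jact x v : Rb x -> j (actV x v) = actM x (j v).
Proof. by move=> bx; case: Hj => _ _ ->. Qed.

Definition wval (u : seq Rgen) (v : V) : M := foldr actM (j v) u.

Lemma wval_lin u (a : C) v v' : wval u (a *: v + v') = a *: wval u v + wval u v'.
Proof. by elim: u => /= [|x u ->]. Qed.

Lemma wval0 u : wval u 0 = 0.
Proof. by elim: u => //= x u ->. Qed.

Lemma wvalZ u (a : C) v : wval u (a *: v) = a *: wval u v.
Proof. by rewrite -[_ *: _ in LHS]addr0 wval_lin wval0 addr0. Qed.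

(** Only the existence of an expression by words with property [Q] is recorded; an element may have
    many. *)
Inductive wspan (Q : seq Rgen -> bool) : M -> Prop :=
| wspan0 : wspan Q 0
| wspan_cons u v w : all gneg u -> Q u -> wspan Q w -> wspan Q (wval u v + w).

Lemma wspan_word (Q : seq Rgen -> bool) u v : all gneg u -> Q u -> wspan Q (wval u v).
Proof. by move=> nu Qu; rewrite -[wval _ _]addr0; apply: wspan_cons => //; apply: wspan0. Qed.

Lemma wspanD Q w w' : wspan Q w -> wspan Q w' -> wspan Q (w + w').
Proof.
elim=> [|u v {}w nu Qu _ IH] Hw'; first by rewrite add0r.
by rewrite -addrA; apply: wspan_cons => //; apply: IH.
Qed.

Lemma wspanZ Q (a : C) w : wspan Q w -> wspan Q (a *: w).
Proof.
elim=> [|u v {}w nu Qu _ IH]; first by rewrite scaler0; apply: wspan0.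
by rewrite scalerDr -wvalZ; apply: wspan_cons.
Qed.

Lemma wspanN Q w : wspan Q w -> wspan Q (- w).
Proof. by rewrite -scaleN1r; apply: wspanZ. Qed.

Lemma wspan_sum Q (I : eqType) (r : seq I) (F : I -> M) :
  (forall i, i \in r -> wspan Q (F i)) -> wspan Q (\sum_(i <- r) F i).
Proof.
move=> H; rewrite big_seq; elim/big_ind: _ => //; [exact: wspan0|exact: wspanD].
Qed.

Lemma wspan_map (Q Q' : seq Rgen -> bool) (f : M -> M) : f 0 = 0 ->
  (forall w w', f (w + w') = f w + f w') ->
  (forall u v, all gneg u -> Q u -> wspan Q' (f (wval u v))) ->
  forall w, wspan Q w -> wspan Q' (f w).
Proof.
move=> f0 fD H w; elim=> [|u v {}w nu Qu _ IH]; first by rewrite f0; apply: wspan0.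
by rewrite fD; apply: wspanD => //; apply: H.
Qed.

Lemma wspan_sub (Q Q' : seq Rgen -> bool) w :
  (forall u, all gneg u -> Q u -> Q' u) -> wspan Q w -> wspan Q' w.
Proof.
move=> H; apply: (wspan_map (f := id)) => // u v nu Qu.
by apply: wspan_word => //; apply: H.
Qed.

Lemma wspan_lbr Q (h : Rgen -> M) x y :
  wspan Q (h (gadd x y)) -> (gidx x + gidx y = 0 -> wspan Q (h Rc)) ->
  wspan Q (lbr h x y).
Proof.
move=> H H0; rewrite lbrE; apply: wspanD; first exact: wspanZ.
have [e|/gce_neq0 ->] := eqVneq (gidx x + gidx y) 0; first exact/wspanZ/H0.
by rewrite scale0r; apply: wspan0.
Qed.

Definition wle (d : int) u : bool := wwt u <= d.
(** Strictly below (d, l) in the lexicographic order; [wlex d 0] means weight below [d], whatever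
    the length. *)
Definition wlex (d : int) (l : nat) u : bool :=
  (wwt u < d) || (wwt u == d) && (size u < l)%N.

Lemma wspan_neg_cons (Q : seq Rgen -> bool) x u v : gneg x -> Q (x :: u) -> all gneg u ->
  wspan Q (actM x (wval u v)).
Proof. by move=> nx Qu nu; apply: (wspan_word (u := x :: u)) => //=; rewrite nx. Qed.

Lemma act_neg_wle x d w : gneg x -> wspan (wle d) w -> wspan (wle (d - gidx x)) (actM x w).
Proof.
move=> nx; apply: wspan_map => // u v nu Qu; apply: wspan_neg_cons => //.
by move: Qu; rewrite /wle /=; lia.
Qed.

(** For [l = 0] the bound concerns the weight alone and stays so; otherwise the new letter costs one
    unit of length. *)
Lemma act_neg_wlex x d l w : gneg x -> wspan (wlex d l) w ->
  wspan (wlex (d - gidx x) (if l is 0 then 0 else l.+1)) (actM x w).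
Proof.
move=> nx; apply: wspan_map => // u v nu Qu; apply: wspan_neg_cons => //.
by move: Qu; rewrite /wlex /=; case: l => [|l]; lia.
Qed.

Lemma act_swap x y d l w : gneg x -> gneg y -> wspan (wlex d l.+1) w ->
  wspan (wlex (d - gidx x - gidx y) l.+2)
    (actM x (actM y w) - gsgn x y *: actM y (actM x w)).
Proof.
move=> nx ny Hw; rewrite (act_rel x y) [_ + lbr _ _ _]addrC addrK.
move: (nx) (ny); rewrite /gneg => nx' ny'.
apply: wspan_lbr => [|e]; last lia.
have nxy : gneg (gadd x y) by rewrite /gneg gidxD; lia.
apply: wspan_sub (act_neg_wlex nxy Hw) => u' _.
by rewrite gidxD /wlex; lia.
Qed.

Lemma wspan_lt0 w : wspan (wlex 0 0) w -> w = 0.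
Proof.
elim=> // u v {}w nu; have := wwt_ge0 nu.
by rewrite /wlex; lia.
Qed.

Lemma wspan_wlex_size d w : wspan (wlex (d + 1) 0) w -> exists l, wspan (wlex d l) w.
Proof.
elim=> [|u v {}w nu Qu _ [l H]]; first by exists 0; apply: wspan0.
exists (maxn (size u).+1 l); apply: wspan_cons => //.
  by move: Qu; rewrite /wlex; lia.
by apply: wspan_sub H => u' _; rewrite /wlex; lia.
Qed.

Lemma pi_wspan Q w : wspan Q w -> wspan Q (piM w).
Proof.
have [pl _ _ par _] := HM.
have pD v v' : piM (v + v') = piM v + piM v' by rewrite -[v in LHS]scale1r pl scale1r.
have p0 : piM 0 = 0 by have := pl (-1) 0 0; rewrite scaler0 addr0 scaleN1r addNr.
have p_word u v : exists v', piM (wval u v) = wval u v'.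
  elim: u v => [|x u IH] v /=; first by exists (piV v); case: Hj => _ ->.
  have [v' e] := IH v; have := par x isT (wval u v); case: ifP => _ ->.
    exists (v - v'); rewrite e; congr (actM x _).
    by rewrite [v - v']addrC -[- v']scaleN1r wval_lin scaleN1r addrC.
  by exists v'; rewrite e.
apply: wspan_map => // u v nu Qu.
by have [v' ->] := p_word u v; apply: wspan_word.
Qed.

(** * Effect of a generator on weight and length *)

Variable t : nat.
Hypothesis t_gt0 : (0 < t)%N.
Hypothesis Vt : forall x, t%:Z < gidx x -> forall v, actV x v = 0.

(* A lower bound for the drop in weight caused by an element of index k. *)
Definition drop_wt (k : int) : int := if k < 0 then k else if k <= t%:Z then 0 else k - t%:Z.

Ltac wt_lia := rewrite /wle /wlex /drop_wt ?gidxD /=; do ?case: ifP => ?; lia.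

(** Commute [g] to the right. The bracket terms fit because [drop_wt (k + i) >= drop_wt k + i] for i
    < 0. *)
Lemma act_wle_word g u v : all gneg u ->
  wspan (wle (wwt u - drop_wt (gidx g))) (actM g (wval u v)).
Proof.
elim: u g v => [|y u IH] g v /=.
  move=> _; have [bg|ng] := boolP (Rb g); last first.
    move: ng; rewrite RbE -ltNge => ng; apply: (wspan_neg_cons (u := [::])) => //.
    by rewrite /wle /= /drop_wt ng.
  rewrite -jact //; have [/Vt ->|tg] := ltP t%:Z (gidx g); first by rewrite j0; apply: wspan0.
  apply: (wspan_word (u := [::])) => //; move: bg; rewrite RbE; wt_lia.
case/andP=> ny nu; rewrite act_rel; apply: wspanD.
  apply: wspanZ; apply: (@wspan_sub (wle (wwt u - drop_wt (gidx g) - gidx y))) => [u' _|].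
    by rewrite /wle; lia.
  exact/act_neg_wle/IH.
move: ny; rewrite /gneg => ny.
apply: wspan_lbr => [|e]; apply: wspan_sub (IH _ _ nu) => u' _;
  wt_lia.
Qed.

Lemma act_wle g d w : wspan (wle d) w -> wspan (wle (d - drop_wt (gidx g))) (actM g w).
Proof.
apply: wspan_map => // u v nu Qu; apply: wspan_sub (act_wle_word g v nu) => u' _.
by move: Qu; rewrite /wle; lia.
Qed.

Definition wsgn g u : C := \prod_(x <- u) gsgn g x.

(** Moving [g] through the word onto the vector produces brackets of index below [t]; they lose
    weight because [t] is positive. *)
Lemma act_t_word g u v : gidx g = t%:Z -> all gneg u ->
  wspan (wlex (wwt u) 0) (actM g (wval u v) - wsgn g u *: wval u (actV g v)).
Proof.
move=> gt; elim: u => [_|y u IH] /=.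
  rewrite /wsgn big_nil scale1r /= jact ?subrr; first exact: wspan0.
  by rewrite RbE gt.
case/andP=> ny nu; rewrite /wsgn big_cons -scalerA -actZ act_rel addrAC -scalerBr -actB.
apply: wspanD.
  by apply: wspanZ; apply: (@act_neg_wlex y (wwt u) 0) => //; apply: IH.
move: ny; rewrite /gneg => ny.
apply: wspan_lbr => [|e]; apply: wspan_sub (act_wle_word _ _ nu) => u' _;
  wt_lia.
Qed.

Lemma act_t_wlex g d l w : gidx g = t%:Z -> wspan (wlex d l) w -> wspan (wlex d l) (actM g w).
Proof.
move=> gt; apply: wspan_map => // u v nu Qu.
rewrite -[actM _ _](subrK (wsgn g u *: wval u (actV g v))); apply: wspanD; last first.
  exact/wspanZ/wspan_word.
apply: wspan_sub (act_t_word v gt nu) => u' _.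
by move: Qu; rewrite /wlex; lia.
Qed.

(** [g] kills V, so only brackets with letters count. A bracket of index below [t] loses extra
    weight, one of index [t] has used up a letter, and one above [t] is handled by induction. *)
Lemma act_gt_word g u v : t%:Z < gidx g -> all gneg u ->
  wspan (wlex (wwt u - (gidx g - t%:Z)) (size u)) (actM g (wval u v)).
Proof.
move=> gt; elim: u g gt => [|y u IH] g gt /=.
  move=> _; rewrite -jact ?Vt // ?j0; first exact: wspan0.
  by rewrite RbE; lia.
case/andP=> ny nu; rewrite act_rel; apply: wspanD.
  apply: wspanZ; have := act_neg_wlex ny (IH g gt nu); apply: wspan_sub => u' _.
  by rewrite /wlex; case: (size u) => [|s]; lia.
move: ny; rewrite /gneg => ny.
apply: wspan_lbr => [|e]; last first.
  apply: wspan_sub (act_wle_word _ _ nu) => u' _.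
  wt_lia.
case: (ltgtP (gidx (gadd g y)) t%:Z) => ht.
- apply: wspan_sub (act_wle_word _ _ nu) => u' _; move: ht; wt_lia.
- apply: wspan_sub (IH _ ht nu) => u' _; rewrite /wlex gidxD; lia.
- rewrite -[actM _ _](subrK (wsgn (gadd g y) u *: wval u (actV (gadd g y) v))).
  apply: wspanD; last apply/wspanZ/wspan_word => //.
    apply: wspan_sub (act_t_word v ht nu) => u' _; move: ht.
    by rewrite /wlex gidxD; lia.
  by move: ht; rewrite /wlex gidxD; lia.
Qed.

Lemma act_gt_wlex g d l w : t%:Z < gidx g -> wspan (wlex d l) w ->
  wspan (wlex (d - (gidx g - t%:Z)) l.-1) (actM g w).
Proof.
move=> gt; apply: wspan_map => // u v nu Qu.
apply: wspan_sub (act_gt_word v gt nu) => u' _.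
by move: Qu; rewrite /wlex; lia.
Qed.

(** * Leading parts *)

(** A finite alphabet that contains every letter of a word in n_- of weight at most [D]. *)
Definition letters (D : nat) : seq Rgen :=
  undup (flatten [seq [:: RL (- m.+1%:Z); RG (- m.+1%:Z)] | m <- iota 0 D]).

Lemma mem_letters D x : (x \in letters D) = gneg x && (- gidx x <= D%:Z).
Proof.
rewrite mem_undup /gneg; apply/flattenP/andP.
  case=> s /mapP[m]; rewrite mem_iota => /= mD -> /=; rewrite !inE.
  by case/orP => /eqP -> /=; lia.
case: x => [m|m|] [//= nm mD]; (exists [:: RL m; RG m]; last by rewrite !inE eqxx ?orbT);
  by apply/mapP; exists `|m|.-1%N; [rewrite mem_iota; lia | congr [:: RL _; RG _]; lia].
Qed.

Lemma letters_neg D x : x \in letters D -> gneg x.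
Proof. by rewrite mem_letters => /andP[]. Qed.

Variable D : nat.
Implicit Types phi psi : seq Rgen -> V.

Fixpoint tens (l : nat) phi : M :=
  if l is l'.+1 then \sum_(x <- letters D) actM x (tens l' (fun u => phi (x :: u)))
  else j (phi [::]).

Definition ssym phi := forall A x y B,
  phi (A ++ [:: x, y & B]) = gsgn x y *: phi (A ++ [:: y, x & B]).

Definition wsupp (d : int) (l : nat) phi := forall u,
  ~~ [&& all gneg u, wwt u == d & size u == l] -> phi u = 0.

Lemma ssym_cons phi x : ssym phi -> ssym (fun u => phi (x :: u)).
Proof. by move=> sp A y z B; apply: (sp (x :: A)). Qed.

Lemma wsupp_cons d l phi x : wsupp d l.+1 phi -> wsupp (d + gidx x) l (fun u => phi (x :: u)).
Proof.
move=> sp u nu; apply: sp; apply: contra nu => /=.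
by case/and3P=> /andP[_ ->] e; rewrite eqSS => -> /=; move: e; lia.
Qed.

Fixpoint words (l : nat) : seq (seq Rgen) :=
  if l is l'.+1 then [seq x :: u | x <- letters D, u <- words l'] else [:: [::]].

Lemma words_neg l u : u \in words l -> all gneg u.
Proof.
elim: l u => [|l IH] u /=; first by rewrite inE => /eqP ->.
by case/allpairsP=> -[x u'] /= [/letters_neg nx /IH nu ->] /=; rewrite nx.
Qed.

Lemma tens_words l phi : tens l phi = \sum_(u <- words l) wval u (phi u).
Proof.
elim: l phi => [|l IH] phi /=; first by rewrite big_seq1.
rewrite big_allpairs_dep /=; apply: eq_bigr => x _.
by rewrite IH act_sum.
Qed.

Lemma tens_lin l (a : C) phi psi :
  tens l (fun u => a *: phi u + psi u) = a *: tens l phi + tens l psi.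
Proof.
rewrite !tens_words scaler_sumr -big_split; apply: eq_bigr => u _ /=.
exact: wval_lin.
Qed.

Lemma eq_tens l phi psi : phi =1 psi -> tens l phi = tens l psi.
Proof. by move=> e; rewrite !tens_words; apply: eq_bigr => u _; rewrite e. Qed.

Lemma tens0 l phi : (forall u, phi u = 0) -> tens l phi = 0.
Proof. by move=> e; rewrite tens_words big1 // => u _; rewrite e wval0. Qed.

Lemma tensZ l (a : C) phi : tens l (fun u => a *: phi u) = a *: tens l phi.
Proof.
rewrite -[RHS]addr0 -(@tens0 l (fun=> 0)) // -tens_lin; apply: eq_tens => u.
by rewrite addr0.
Qed.

Lemma tensD l phi psi : tens l (fun u => phi u + psi u) = tens l phi + tens l psi.
Proof.
rewrite -[tens l phi]scale1r -tens_lin; apply: eq_tens => u.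
by rewrite scale1r.
Qed.

Lemma tens_span d l phi : wsupp d l phi -> wspan (wlex d l.+1) (tens l phi).
Proof.
move=> sp; rewrite tens_words; apply: wspan_sum => u /words_neg nu.
have [/and3P[_ /eqP wu /eqP su]|/sp ->] := boolP [&& all gneg u, wwt u == d & size u == l].
  by apply: wspan_word => //; rewrite /wlex wu su eqxx ltnSn orbT.
by rewrite wval0; apply: wspan0.
Qed.

Lemma act_t_tens g d l phi : gidx g = t%:Z -> wsupp d l phi ->
  wspan (wlex d 0) (actM g (tens l phi) - tens l (fun u => wsgn g u *: actV g (phi u))).
Proof.
move=> gt sp; rewrite !tens_words act_sum -sumrB; apply: wspan_sum => u /words_neg nu.
rewrite wvalZ.
have [/and3P[_ /eqP wu /eqP su]|/sp ->] := boolP [&& all gneg u, wwt u == d & size u == l].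
  by rewrite -wu; apply: act_t_word.
rewrite (_ : actV g 0 = 0) ?wval0 ?act0 ?scaler0 ?subrr; first exact: wspan0.
have bg : Rb g by rewrite RbE gt.
by have := actV_lin HV (-1) 0 0 bg; rewrite scaler0 addr0 scaleN1r addNr.
Qed.

(* The shuffle product of the letter y with psi. *)
Fixpoint ins (y : Rgen) psi (u : seq Rgen) : V :=
  if u is x :: u' then
    (x == y)%:R *: psi u' + gsgn x y *: ins y (fun u => psi (x :: u)) u'
  else 0.

Lemma insZ y (a : C) psi u : ins y (fun u => a *: psi u) u = a *: ins y psi u.
Proof.
elim: u psi => [|x u IH] psi /=; first by rewrite scaler0.
by rewrite IH scalerDr !scalerA ![a * _]mulrC.
Qed.

Lemma eq_ins y psi psi' u : psi =1 psi' -> ins y psi u = ins y psi' u.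
Proof. by elim: u psi psi' => //= x u IH psi psi' e; rewrite e (IH _ (fun u => psi' (x :: u))). Qed.

Lemma ssym_ins y psi : ssym psi -> ssym (ins y psi).
Proof.
move=> sp A; elim: A psi sp => [|a A IH] psi sp x z B /=; last first.
  by rewrite sp (IH _ (ssym_cons a sp)) scalerDr !scalerA ![gsgn x z * _]mulrC.
rewrite (@eq_ins _ (fun u => psi [:: x, z & u]) (fun u => gsgn x z *: psi [:: z, x & u])).
  rewrite insZ !scalerDr !scalerA [RHS](AC (1*2) (2*1*3)) addrA.
  congr (_ + _ + _ *: _); last by ring.
  - have [->|_] := eqVneq x y; last by rewrite mulr0n !mulr0.
    by rewrite [gsgn y z]gsgnC gsgn2 !mul1r.
  - have [->|_] := eqVneq z y; last by rewrite mulr0n !mulr0.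
    by rewrite mulrC.
by move=> u; apply: (sp [::]).
Qed.

Lemma ins0 y psi u : (forall w, psi w = 0) -> ins y psi u = 0.
Proof.
move=> p0; rewrite (@eq_ins _ _ (fun w => 0 *: psi w)) => [|w].
  by rewrite insZ scale0r.
by rewrite p0 scaler0.
Qed.

Lemma wsupp_ins y d l psi : gneg y -> wsupp d l psi -> wsupp (d - gidx y) l.+1 (ins y psi).
Proof.
move=> ny sp u; elim: u d l psi sp => //= x u IH d l psi sp nu.
have -> : (x == y)%:R *: psi u = 0.
  have [e|_] := eqVneq x y; last by rewrite scale0r.
  rewrite sp ?scaler0 //; apply: contra nu => /and3P[-> /eqP <- /eqP ->].
  by rewrite e ny eqxx /= eqxx.
rewrite add0r; case: l sp nu => [|l] sp nu.
  by rewrite ins0 ?scaler0 // => w; rewrite sp //= !andbF.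
have [nx|nx] := boolP (gneg x); last first.
  by rewrite ins0 ?scaler0 // => w; rewrite sp //= (negPf nx).
rewrite (IH _ _ _ (wsupp_cons (x := x) sp)) ?scaler0 //; apply: contra nu.
by case/and3P=> -> e /eqP ->; rewrite nx eqxx andbT /=; move: e; lia.
Qed.

(** The shuffle inserts [y] at each of the l + 1 positions; moving it to the front changes the word
    only by lower terms. *)
Lemma tens_ins y d l psi : y \in letters D -> wsupp d l psi ->
  wspan (wlex (d - gidx y) l.+1) (tens l.+1 (ins y psi) - l.+1%:R *: actM y (tens l psi)).
Proof.
move=> yD; have ny := letters_neg yD.
have E l' phi : tens l'.+1 (ins y phi) = actM y (tens l' phi) +
    \sum_(x <- letters D) gsgn x y *: actM x (tens l' (ins y (fun u => phi (x :: u)))).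
  rewrite /= (eq_bigr (fun x => (x == y)%:R *: actM y (tens l' phi) + gsgn x y *:
      actM x (tens l' (ins y (fun u => phi (x :: u)))))); last first.
    move=> x _; rewrite tens_lin tensZ actD !actZ; congr (_ + _).
    by have [->|_] := eqVneq x y; rewrite // !scale0r.
  rewrite big_split /=; congr (_ + _).
  rewrite (bigD1_seq y) ?undup_uniq //= eqxx scale1r big1 ?addr0 // => x /negPf ->.
  by rewrite scale0r.
elim: l d psi => [|l IH] d psi sp.
  rewrite E big1 => [|x _]; last by rewrite /= j0 act0 scaler0.
  by rewrite addr0 scale1r subrr; apply: wspan0.
rewrite E mulrSr scalerDl scale1r opprD.
rewrite [X in wspan _ X](+%R.[AC (2*2) ((1*4)*(2*3))]) subrr add0r.
rewrite {2}/tens -/tens act_sum scaler_sumr -sumrB; apply: wspan_sum => x xD.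
have nx := letters_neg xD; have sx := wsupp_cons (x := x) sp.
rewrite -[X in wspan _ X](subrK (l.+1%:R *: (gsgn x y *:
  actM x (actM y (tens l (fun u => psi (x :: u))))))).
rewrite [X in wspan _ X](+%R.[ACl (1*3)*(4*2)]); apply: wspanD.
  rewrite scalerA [_ * gsgn _ _]mulrC -scalerA -[_%:R *: _]actZ -scalerBr -actB; apply: wspanZ.
  have := act_neg_wlex nx (IH _ _ sx); apply: wspan_sub => u _.
  by rewrite /wlex; lia.
(* What remains is the supercommutator of [x] and [y], which is shorter by [act_swap]. *)
rewrite -scalerBr; apply: wspanZ.
rewrite -[X in wspan _ (_ - X)]scale1r -(gsgn2 R x y) -scalerA -scalerBr; apply: wspanZ.
have := act_swap nx ny (tens_span sx); apply: wspan_sub => u _.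
by rewrite /wlex; lia.
Qed.

(** Symmetrize the tail, then shuffle in the first letter and divide by the number of positions,
    using [tens_ins]. *)
Lemma symmetrize_word u v : all gneg u -> wwt u <= D%:Z ->
  exists phi, [/\ ssym phi, wsupp (wwt u) (size u) phi &
    wspan (wlex (wwt u) (size u)) (wval u v - tens (size u) phi)].
Proof.
elim: u => [|y u IH] /=.
  move=> _ _; exists (fun u => if u is [::] then v else 0); split.
  - by move=> [|a A] x y B /=; rewrite scaler0.
  - by case.
  - by rewrite /= subrr; apply: wspan0.
case/andP=> ny nu le; have u0 := wwt_ge0 nu.
have [|phi [sp su H]] := IH nu; first by move: ny; rewrite /gneg; lia.
have yD : y \in letters D by rewrite mem_letters ny /=; lia.
exists (fun w => (size u).+1%:R^-1 *: ins y phi w); split.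
- by move=> A x z B; rewrite (ssym_ins y sp) !scalerA mulrC.
- by move=> w nw; rewrite (wsupp_ins ny su) ?scaler0.
rewrite -[X in wspan _ (_ - X)]/(tens (size u).+1
  (fun w => (size u).+1%:R^-1 *: ins y phi w)) tensZ.
rewrite -[X in wspan _ X](subrK (actM y (tens (size u) phi))).
rewrite [X in wspan _ X](+%R.[ACl (1*3)*(4*2)]) -actB; apply: wspanD.
  have := act_neg_wlex ny H; apply: wspan_sub => w _.
  by rewrite /wlex; case: (size u) => [|s]; lia.
have n0 : (size u).+1%:R != 0 :> C by rewrite pnatr_eq0.
rewrite -[actM y _](scalerK n0) -scalerBr; apply: wspanZ.
rewrite -[X in wspan _ X]opprB; apply: wspanN; exact: tens_ins.
Qed.

Lemma symmetrize d l w : d <= D%:Z -> wspan (wlex d l.+1) w ->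
  exists phi, [/\ ssym phi, wsupp d l phi & wspan (wlex d l) (w - tens l phi)].
Proof.
move=> dD; elim=> [|u v {}w nu Qu _ [phi [sp su H]]].
  exists (fun=> 0); split=> //; first by move=> A x y B; rewrite scaler0.
  by rewrite tens0 // subrr; apply: wspan0.
have [Ql|nQl] := boolP (wlex d l u).
  by exists phi; split=> //; rewrite -addrA; apply: wspanD => //; apply: wspan_word.
have [wu lu] : wwt u = d /\ size u = l by move: Qu nQl; rewrite /wlex; lia.
have [|psi [sp' su' H']] := symmetrize_word v nu; first by rewrite wu.
rewrite {}wu {}lu in su' H'; exists (fun u => phi u + psi u); split.
- by move=> A x y B; rewrite sp sp' scalerDr.
- by move=> u' nu'; rewrite su ?su' ?addr0.
rewrite tensD [tens l phi + _]addrC opprD addrACA; exact: wspanD.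
Qed.

Definition raise (x : Rgen) : Rgen :=
  match x with RL k => RL (t%:Z - k) | RG k => RG (t%:Z - k) | Rc => Rc end.

Lemma gidx_raise x : gneg x -> gidx (raise x) = t%:Z - gidx x.
Proof. by case: x. Qed.

(** The coefficient is t - 2k > 0 for L_k with k < 0, and 2 for G_k. *)
Lemma gco_raise_neq0 x : gneg x -> gco (raise x) x != 0.
Proof.
case: x => [k|k|] // nk; last by rewrite /= pnatr_eq0.
by rewrite /= intr_eq0; move: nk; rewrite /gneg /=; lia.
Qed.

Lemma tensS l phi :
  tens l.+1 phi = \sum_(x <- letters D) actM x (tens l (fun u => phi (x :: u))).
Proof. by []. Qed.

Arguments tens : simpl never.

(** [raise x] has index above [t] and kills V, so only its brackets with letters matter. By
    supersymmetry each of the l + 1 positions contributes the same, whence the factor. *)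
Lemma raise_tens x d l phi : x \in letters D -> ssym phi -> wsupp d l.+1 phi ->
  (forall u, actV (RG t%:Z) (phi u) = 0) ->
  wspan (wlex (d + gidx x) l) (actM (raise x) (tens l.+1 phi) -
    tens l (fun u => (l.+1%:R * gco (raise x) x) *: actV (RL t%:Z) (phi (x :: u)))).
Proof.
move=> xD; have nx := letters_neg xD; have ix := gidx_raise nx.
have Lb : Rb (RL t%:Z) by [].
have L0 : actV (RL t%:Z) 0 = 0.
  by have := actV_lin HV (-1) 0 0 Lb; rewrite scaler0 addr0 scaleN1r addNr.
have LZ (a : C) v : actV (RL t%:Z) (a *: v) = a *: actV (RL t%:Z) v.
  by rewrite -[_ *: _ in LHS]addr0 (actV_lin HV) // L0 addr0.
set Lt := actV (RL t%:Z); set Gt := actV (RG t%:Z).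
set c := gco (raise x) x.
have sgr y : gsgn (raise x) y = gsgn x y by case: (x).
(* Among the brackets [raise x, y], only y = x contributes at leading order:
   another letter of the same index gives G_t, which kills the coefficients. *)
have E d' l' phi' : wsupp d' l'.+1 phi' -> (forall u, Gt (phi' u) = 0) ->
  wspan (wlex (d' + gidx x) l')
   (\sum_(y <- letters D) lbr (actM^~ (tens l' (fun u => phi' (y :: u)))) (raise x) y
    - c *: tens l' (fun u => Lt (phi' (x :: u)))).
  move=> sp G0.
  have -> : c *: tens l' (fun u => Lt (phi' (x :: u))) =
      \sum_(y <- letters D) (if y == x then c *: tens l' (fun u => Lt (phi' (x :: u))) else 0).
    rewrite (bigD1_seq x) ?undup_uniq //= eqxx big1 ?addr0 // => y /negPf ->.
    by [].
  rewrite -sumrB; apply: wspan_sum => y yD; have ny := letters_neg yD.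
  have Hy := wsupp_cons (x := y) sp; have Ty := tens_span Hy.
  move: (nx) (ny); rewrite /gneg => nx' ny'.
  have Ty' : wspan (wle (d' + gidx y)) (tens l' (fun u => phi' (y :: u))).
    by apply: wspan_sub Ty => u _; rewrite /wlex /wle; lia.
  have Ly : gidx (raise x) + gidx y = 0 ->
      wspan (wlex (d' + gidx x) l') (actM Rc (tens l' (fun u => phi' (y :: u)))).
    move=> e; have := act_wle Rc Ty'; apply: wspan_sub => u _.
    by move: e; rewrite ix; wt_lia.
  have [exy|nxy] := eqVneq (gidx x) (gidx y); last first.
    have -> : (y == x) = false by apply: contraNF nxy => /eqP ->.
    rewrite subr0; apply: wspan_lbr => //.
    (* A letter of index below that of [x] gives a bracket of index below [t], which loses weight;
       one of larger index gives a bracket of index above [t], which loses length. *)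
    have [lt|ge] := ltP (gidx y) (gidx x).
      have := act_wle (gadd (raise x) y) Ty'; apply: wspan_sub => u _.
      by move: lt; rewrite /wle /wlex /drop_wt gidxD ix; do ?case: ifP => ?; lia.
    have ht : t%:Z < gidx (gadd (raise x) y) by rewrite gidxD ix; lia.
    have := act_gt_wlex ht Ty; apply: wspan_sub => u _.
    by rewrite /wlex gidxD ix; lia.
  rewrite lbrE gce_neq0 ?scale0r ?addr0; last by rewrite ix -exy; lia.
  have [->|yx] := eqVneq y x.
    have -> : gadd (raise x) x = RL t%:Z.
      by case: (x) nx => //= k _; congr RL; lia.
    rewrite -/c -scalerBr; apply: wspanZ.
    have := act_t_tens (g := RL t%:Z) (erefl _) (wsupp_cons (x := x) sp).
    rewrite (@eq_tens _ (fun u => wsgn _ u *: _) (fun u => Lt (phi' (x :: u)))) => [|u]; last first.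
      rewrite (_ : wsgn _ _ = 1) ?scale1r //.
      by apply: big1_seq => z _; rewrite /gsgn.
    by apply: wspan_sub => u _; rewrite /wlex; lia.
  have -> : gadd (raise x) y = RG t%:Z.
    case: (x) (y) nx' ny' exy yx => [k|k|] [m|m|] //= _ _ -> ;
      by rewrite ?eqxx // => _; congr RG; lia.
  rewrite subr0; apply: wspanZ.
  have := act_t_tens (g := RG t%:Z) (erefl _) Hy.
  rewrite (@tens0 _ (fun u => _ *: _)) ?subr0 => [|u]; last by rewrite -/Gt G0 scaler0.
  by apply: wspan_sub => u _; rewrite /wlex; lia.
elim: l d phi => [|l IH] d phi sy sp G0.
  have := E _ _ _ sp G0; rewrite mul1r tensZ; congr wspan.
  rewrite tensS act_sum; congr (_ - _); apply: eq_bigr => y _.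
  rewrite act_rel -jact ?Vt ?j0 ?act0 ?scaler0 ?add0r // ?RbE ?ix.
    by move: nx; rewrite /gneg; lia.
  by move: nx; rewrite /gneg; lia.
rewrite [tens l.+2 _]tensS act_sum.
rewrite (eq_bigr _ (fun y _ => act_rel (raise x) y _)) big_split /=.
(* One copy comes from the bracket with the first letter, by [E]; the other l + 1 come from the
   later letters, by induction. *)
rewrite (@tensZ l.+1) mulrSr mulrDl mul1r scalerDl opprD addrACA.
apply: wspanD; last exact: E.
rewrite -[X in _ - X](@tensZ l.+1) [X in _ - X]tensS -sumrB; apply: wspan_sum => y yD.
have ny := letters_neg yD.
(* Supersymmetry exchanges [x] and [y]; its sign is the one from commuting [raise x] past [y]. *)
rewrite (@eq_tens _ (fun u => (l.+1%:R * c) *: Lt (phi [:: x, y & u]))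
  (fun u => gsgn x y *: ((l.+1%:R * c) *: Lt (phi [:: y, x & u])))).
  rewrite tensZ actZ sgr -scalerBr -actB; apply: wspanZ.
  have := act_neg_wlex ny (IH _ _ (ssym_cons y sy) (wsupp_cons (x := y) sp) (fun u => G0 _)).
  by apply: wspan_sub => u _; rewrite /wlex; case: l {IH sp} => [|l']; lia.
by move=> u; rewrite /Lt (sy [::]) LZ !scalerA mulrC.
Qed.

(** * Descent to V *)

Section Reach.
Hypothesis Linj : injective (actV (RL t%:Z)).
Variable W : M -> Prop.
Hypothesis Wact : forall x w, W w -> W (actM x w).

Let Lb : Rb (RL t%:Z). Proof. by []. Qed.
Let Gb : Rb (RG t%:Z). Proof. by []. Qed.

Let av0 x : Rb x -> actV x 0 = 0.
Proof.
by move=> bx; have := actV_lin HV (-1) 0 0 bx; rewrite scaler0 addr0 scaleN1r addNr.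
Qed.

Let avZ x (a : C) v : Rb x -> actV x (a *: v) = a *: actV x v.
Proof. by move=> bx; rewrite -[_ *: _ in LHS]addr0 (actV_lin HV) // av0 // addr0. Qed.

(** [G_t, L_t] is a multiple of G_{2t}, which is zero on V since 2t > t. Thus the vanishing under
    G_t survives the descent. *)
Let GL v : actV (RG t%:Z) v = 0 -> actV (RG t%:Z) (actV (RL t%:Z) v) = 0.
Proof.
move=> Gv; have := actV_rel HV Gb Lb v.
rewrite Gv av0 // scaler0 subr0 => ->; rewrite lbrE gce_neq0 ?scale0r ?addr0 /=; last by lia.
by rewrite Vt ?scaler0 //=; lia.
Qed.

Let GG v : actV (RG t%:Z) (actV (RG t%:Z) v) = 0.
Proof.
have := actV_rel HV Gb Gb v; rewrite scaleN1r opprK lbrE gce_neq0 /=; last by lia.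
rewrite scale0r addr0 (@Vt (RL (t%:Z + t%:Z))) /=; last by lia.
rewrite scaler0 -mulr2n -scaler_nat => /eqP; rewrite scaler_eq0 pnatr_eq0 /=.
by move/eqP.
Qed.

(** Induction on a word [X] where the leading part is nonzero: raising its first letter passes to a
    multiple of L_t phi(x _), nonzero at the tail because L_t is injective. *)
Lemma lower_top X w d phi : d <= D%:Z -> W w -> ssym phi -> wsupp d (size X) phi ->
  (forall u, actV (RG t%:Z) (phi u) = 0) -> phi X != 0 ->
  wspan (wlex d (size X)) (w - tens (size X) phi) ->
  exists v, v != 0 /\ W (j v).
Proof.
elim: X w d phi => [|x X IH] w d phi dD Ww sy sp G0 X0 Hw.
  exists (phi [::]); split=> //.
  (* The empty word lies in the support, so [d] is its weight 0, and the remainder lies in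
     [wlex 0 0], hence is zero. *)
  have d0 : d = 0.
    by apply/esym/eqP; apply: contraNT X0 => d0; rewrite sp //= andbT.
  rewrite d0 in Hw; have /subr0_eq e := wspan_lt0 Hw.
  by move: Ww; rewrite e.
have /and3P[/= /andP[nx nX] /eqP wX _] :
    [&& all gneg (x :: X), wwt (x :: X) == d & size (x :: X) == (size X).+1].
  by apply: contraNT X0 => /sp ->.
have wX0 := wwt_ge0 nX; move: (nx); rewrite /gneg => nx'.
have xD : x \in letters D by rewrite mem_letters nx; lia.
have c0 : (size X).+1%:R * gco (raise x) x != 0 :> C.
  by rewrite mulf_neq0 ?pnatr_eq0 ?gco_raise_neq0.
apply: (IH (actM (raise x) w) (d + gidx x) (fun u => ((size X).+1%:R * gco (raise x) x) *:
   actV (RL t%:Z) (phi (x :: u)))).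
- by lia.
- exact: Wact.
- by move=> A y z B; rewrite (ssym_cons x sy) avZ // !scalerA mulrC.
- by move=> u nu; rewrite (wsupp_cons sp) // av0 // scaler0.
- by move=> u; rewrite avZ // GL ?scaler0.
- rewrite scaler_eq0 negb_or c0 /=; apply: contra X0 => /eqP e.
  by apply/eqP/Linj; rewrite e av0.
rewrite -[X in wspan _ X](subrK (actM (raise x) (tens (size X).+1 phi))).
rewrite [X in wspan _ X](+%R.[ACl (1*3)*(4*2)]) -actB; apply: wspanD.
  have rt : t%:Z < gidx (raise x) by rewrite gidx_raise //; lia.
  have := act_gt_wlex rt Hw; apply: wspan_sub => u _.
  by rewrite /wlex gidx_raise //=; lia.
exact: raise_tens.
Qed.

Lemma reach_step d l w : d <= D%:Z -> W w -> wspan (wlex d l.+1) w ->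
  wspan (wlex d l) w \/ exists v, v != 0 /\ W (j v).
Proof.
move=> dD Ww /(symmetrize dD) [phi [sy sp H]].
have sz psi X : wsupp d l psi -> psi X != 0 -> size X = l.
  move=> su X0; apply/eqP.
  have : [&& all gneg X, wwt X == d & size X == l] by apply: contraNT X0 => /su ->.
  by case/and3P.
have [[X GX]|G0] := pselect (exists X, actV (RG t%:Z) (phi X) != 0).
  (* G_t squares to 0 on V, so applying it first makes G_t kill all coefficients. *)
  pose psi u := wsgn (RG t%:Z) u *: actV (RG t%:Z) (phi u).
  have su : wsupp d l psi by move=> u nu; rewrite /psi sp // av0 // scaler0.
  have ws0 u : wsgn (RG t%:Z) u != 0.
    by rewrite /wsgn prodf_seq_neq0; apply/allP => z _; rewrite signr_eq0.
  have X0 : psi X != 0 by rewrite scaler_eq0 negb_or ws0.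
  right; have e := sz psi X su X0; subst l.
  apply: (@lower_top X (actM (RG t%:Z) w) d psi) => //.
  - exact: Wact.
  - move=> A x y B; rewrite /psi sy avZ // !scalerA mulrC; congr (_ * _ *: _).
    by rewrite /wsgn !big_cat /= !big_cons; congr (_ * _); rewrite mulrCA.
  - by move=> u; rewrite /psi avZ // GG scaler0.
  rewrite -[X in wspan _ X](subrK (actM (RG t%:Z) (tens (size X) phi))).
  rewrite [X in wspan _ X](+%R.[ACl (1*3)*(4*2)]) -actB; apply: wspanD.
    exact: act_t_wlex.
  have := @act_t_tens (RG t%:Z) d (size X) phi erefl sp; apply: wspan_sub => u _.
  by rewrite /wlex; lia.
have {}G0 u : actV (RG t%:Z) (phi u) = 0.
  by apply/eqP/negPn/negP => Gu; apply: G0; exists u.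
have [[X X0]|phi0] := pselect (exists X, phi X != 0).
  right; have e := sz phi X sp X0; subst l.
  exact: (@lower_top X w d phi).
left; rewrite tens0 ?subr0 // in H => u.
by apply/eqP/negPn/negP => pu; apply: phi0; exists u.
Qed.

(** Induction on weight, then on length. At length 0 the weight drops, and a new length bound exists
    because only finitely many words occur. *)
Lemma reach_bottom (n l : nat) w : (n <= D)%N -> W w -> w != 0 ->
  wspan (wlex n%:Z l) w -> exists v, v != 0 /\ W (j v).
Proof.
move=> + Ww w0; elim: n l => [|n IHn]; elim=> [|l IHl] nD Hw.
- by rewrite (wspan_lt0 Hw) eqxx in w0.
- by case: (reach_step _ Ww Hw) => // /IHl; apply.
- have [l Hl] : exists l, wspan (wlex n%:Z l) w.
    by apply: wspan_wlex_size; apply: wspan_sub Hw => u _; rewrite /wlex; lia.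
  by apply: (IHn l) => //; lia.
- by case: (reach_step _ Ww Hw) => // /IHl; apply.
Qed.

End Reach.

(** Together with [iota_span] this makes every element of M a sum of words of bounded weight. *)
Lemma wspan_wle_gsubmod :
  is_gsubmod Rall piM actM (fun w => exists n : nat, wspan (wle n%:Z) w).
Proof.
split.
- by exists 0; apply: wspan0.
- move=> a u v [m Hm] [n Hn]; exists (maxn m n); apply: wspanD.
    by apply: wspanZ; apply: wspan_sub Hm => u' _; rewrite /wle; lia.
  by apply: wspan_sub Hn => u' _; rewrite /wle; lia.
- by move=> v [n Hn]; exists n; apply: pi_wspan.
- move=> x _ v [n Hn]; exists (n + `|gidx x|)%N.
  by apply: wspan_sub (act_wle x Hn) => u _; wt_lia.
Qed.

End Filtration.

(** * Simplicity and smoothness of the induced module *)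

Theorem theorem3p3 (R : realType)
    (V : lmodType R[i]) (piV : V -> V) (actV : Rgen -> V -> V)
    (M : lmodType R[i]) (piM : M -> M) (actM : Rgen -> M -> M) (iota : V -> M) :
  is_smod Rb piV actV ->
  is_simple Rb piV actV ->
  (exists t : nat, (0 < t)%N /\
     (forall u v : V, actV (RL t%:Z) u = actV (RL t%:Z) v -> u = v) /\
     (forall i : int, (t%:Z < i)%R -> forall v : V, actV (RL i) v = 0)) ->
  is_induced piV actV piM actM iota ->
  is_simple Rall piM actM /\ is_smooth actM.
Proof.
move=> HV [[v0 v0n] Vsimple] [t [t0 [Linj LV]]] HI.
have [HM Hi _] := HI.
have Vt x : t%:Z < gidx x -> forall v, actV x v = 0.
  case: x => [i|i|] //= ti v; first exact: LV.
  (* G_i vanishes on V as well, because [L_i, G_0] = (i/2) G_i with i nonzero. *)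
  have [_ _ al _ [_ LG _ _]] := HV.
  have i0 : 0 <= i by lia.
  have := LG i 0 i0 (lexx 0) v; rewrite !LV // addr0 subr0.
  have -> : actV (RG 0) 0 = 0.
    by have := al (RG 0) (lexx 0) (-1) 0 0; rewrite scaler0 addr0 scaleN1r addNr.
  rewrite subrr => /esym/eqP; rewrite scaler_eq0 mulf_eq0 invr_eq0 pnatr_eq0 orbF intr_eq0.
  by case/orP => [|/eqP //]; lia.
have span := iota_span HI (wspan_wle_gsubmod HM Hi t0 Vt).
have {}span w : exists n : nat, wspan actM iota (wle n%:Z) w.
  by apply: span => v; exists 0; apply: (@wspan_word _ _ _ actM iota _ [::]).
have iI := iota_inj HV HI.
have [il ipi iact] := Hi.
have i0 : iota 0 = 0 by have := il (-1) 0 0; rewrite scaler0 addr0 scaleN1r addNr.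
split; last first.
  (* Index m > t + n lowers the weight by m - t > n, hence below zero, where no word remains. *)
  move=> w; have [n Hn] := span w; exists (t + n)%N => m tm.
  have kill x : gidx x = m -> actM x w = 0.
    move=> xm; apply: (@wspan_lt0 _ _ _ actM iota).
    apply: wspan_sub (act_wle HM Hi t0 Vt x Hn) => u nu; have := wwt_ge0 nu.
    by rewrite /wle /wlex /drop_wt xm; do ?case: ifP => ?; lia.
  by split; apply: kill.
split; first by exists (iota v0); rewrite -i0 (inj_eq iI).
move=> W [W0 Wl Wpi Wact].
have [[w [Ww w0]]|N] := pselect (exists w, W w /\ w != 0); last first.
  by left=> v Wv; apply/eqP/negPn/negP => v0'; apply: N; exists v.
right; have [n Hn] := span w.
(* Weight at most n is weight below n + 1; the alphabet bound [D] is taken to be n + 1. *)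
have Hn' : wspan actM iota (wlex n.+1%:Z 0) w.
  by apply: wspan_sub Hn => u _; rewrite /wle /wlex; lia.
have Wact' x v : W v -> W (actM x v) by apply: Wact.
have [v [vn Wv]] := reach_bottom HV HM Hi t0 Vt Linj Wact' (leqnn n.+1) Ww w0 Hn'.
(* The preimage of [W] in V is a graded b-submodule containing a nonzero vector, so it is all of
   V. *)
have [||H] := Vsimple (fun v => W (iota v)).
- split=> [|a u u' Wu Wu'|u Wu|x bx u Wu].
  + by rewrite i0.
  + by rewrite il; apply: Wl.
  + by rewrite ipi; apply: Wpi.
  + by rewrite iact //; apply: Wact.
- by move/(_ v Wv) => e; rewrite e eqxx in vn.
exact: (iota_span HI).
Qed.
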